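(* Let $\mathbf{F}_q$ be a finite field and let $Y$ and $\mathcal{F}_4$ be the surface over $\mathbf{F}_q$ and the line bundle described in the context. The parameters of the code $C_L(Y,\mathcal{F}_4)$ are $$[(q+1)^2,\ 8,\ q^2-q-2],$$ i.e. length $(q+1)^2$, dimension $8$ and minimum distance $q^2-q-2$.
   Context: Let $P$ be a rational point of $\mathbf{P}^2$ over $\mathbf{F}_q$. Let $l$ and $l^{\varphi}$ be a pair of distinct lines defined over $\mathbf{F}_{q^2}$, conjugate under the Frobenius $\varphi$ and meeting at $P$, and let $D:=l\cup l^{\varphi}$, a conic defined over $\mathbf{F}_q$. Let $R$ be a closed point of degree $4$ lying on $D$. Let $\pi:Y\to\mathbf{P}^2$ be the blow up of $\mathbf{P}^2$ at $P$ and $R$, with exceptional divisors $E$ above $P$ and $F$ above $R$. Let $\Lambda_4$ be the linear system of plane curves of degree $4$ containing $R$ with multiplicity at least $1$ and $P$ with multiplicity at least $2$, and let $\mathcal{F}_4$ be the line bundle on $Y$ associated to the linear system $\pi^{\star}\Lambda_4-2E-F$. For a line bundle $\mathcal{L}$ on a smooth projective geometrically irreducible surface $X$ over $\mathbf{F}_q$ with rational points $X(\mathbf{F}_q)=\{P_1,\dots,P_n\}$ (all of them), the code $C_L(X,\mathcal{L})\subset \mathbf{F}_q^n$ is the image of the evaluation map $H^0(X,\mathcal{L})\to\bigoplus_i \mathcal{L}_{P_i}\simeq\mathbf{F}_q^n$, $f\mapsto (f_{P_1},\dots,f_{P_n})$, where a coordinate has been chosen on each fibre (different choices give codes isometric for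 the Hamming distance). A code with parameters $[n,k,d]$ has length $n$, dimension $k$ and minimum Hamming distance $d$.
   Formalization: The minimum distance is claimed only for q > 2: for q = 2 the printed value q^2-q-2 is 0, impossible for a code of dimension 8; length and dimension are proved for all q. *)

(* Defs.v *)
From HB Require Import structures.
From mathcomp Require Import all_boot all_order all_algebra.
From mathcomp Require Import mpoly.

Set Implicit Arguments.
Unset Strict Implicit.
Unset Printing Implicit Defensive.

Import GRing.Theory.
Local Open Scope ring_scope.

(* Throughout, F is the base field with q = #|F| elements and iota : F -> K    *)
(* embeds it in an algebraically closed field K. A point of P^2 is given by a  *)
(* nonzero row vector of homogeneous coordinates, two vectors giving the same  *)
(* point when their row spaces agree: (u == v)%MS. A line is given likewise by *)
(* the row vector l of the coefficients of its equation.                       *)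

Definition on_line (k : fieldType) (v l : 'rV[k]_3) : Prop := v *m l^T = 0.

Definition frobenius (F : finFieldType) (K : fieldType) (v : 'rV[K]_3) :
    'rV[K]_3 :=
  map_mx (fun x => x ^+ #|F|) v.

(* A closed point of degree d of P^2 over F is the Frobenius orbit, of         *)
(* cardinality d, of a geometric point; r is one point of the orbit.           *)
Definition closed_point (F : finFieldType) (K : fieldType) (d : nat)
    (r : 'rV[K]_3) : Prop :=
  [/\ r != 0, (iter d (@frobenius F K) r == r)%MS
    & forall i, (0 < i < d)%N -> ~~ (iter i (@frobenius F K) r == r)%MS].

(* l is defined over the quadratic extension of F and distinct from its        *)
(* Frobenius conjugate.                                                        *)
Definition quadratic_line (F : finFieldType) (K : fieldType)
    (l : 'rV[K]_3) : Prop :=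
  [/\ l != 0, (frobenius F (frobenius F l) == l)%MS
    & ~~ (frobenius F l == l)%MS].

Section LocalExpansion.
Variables (F : finFieldType) (K : closedFieldType) (iota : {rmorphism F -> K}).

(* The degree i part of p (v + X).  For a form p this is, up to the choice of  *)
(* the affine chart, the degree i part of the local expansion of p at v.       *)
Definition expansion (i : nat) (v : 'rV[K]_3) (p : {mpoly F[3]}) :
    {mpoly K[3]} :=
  pihomog mdeg i
    (map_mpoly iota p \mPo [tuple 'X_j + (v 0 j)%:MP | j < 3]).

Definition vanishes_to_order (m : nat) (v : 'rV[K]_3) (p : {mpoly F[3]}) :
    Prop :=
  forall i, (i < m)%N -> expansion i v p = 0.

Definition value_at (v : 'rV[K]_3) (p : {mpoly F[3]}) : K :=
  (map_mpoly iota p).@[fun j => v 0 j].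

Definition expansion_at (i : nat) (v w : 'rV[K]_3) (p : {mpoly F[3]}) : K :=
  (expansion i v p).@[fun j => w 0 j].

End LocalExpansion.

(* Points of the blow-up of P^2 at finitely many points: [Off v] is the point  *)
(* above v when v is not a centre; [Exc v w] is the point of the exceptional   *)
(* curve above the centre v which corresponds to the tangent direction of the  *)
(* line through v and w.                                                       *)
Variant blowup_point (k : fieldType) : Type :=
  | Off of 'rV[k]_3
  | Exc of 'rV[k]_3 & 'rV[k]_3.

Definition same_point (k : fieldType) (y z : blowup_point k) : bool :=
  match y, z with
  | Off v, Off v' => (v == v')%MS
  | Exc v w, Exc v' w' =>
      (v == v')%MS && (col_mx v w == col_mx v' w')%MS
  | _, _ => false
  end.

Definition map_point (k k' : fieldType) (f : {rmorphism k -> k'})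
    (y : blowup_point k) : blowup_point k' :=
  match y with
  | Off v => Off (map_mx f v)
  | Exc v w => Exc (map_mx f v) (map_mx f w)
  end.

(* The surface Y: the blow-up of P^2 at the rational point P and at the closed *)
(* point R of degree 4 which is the Frobenius orbit of r; E and F_R are the    *)
(* exceptional curves above P and R.                                           *)
Section Surface.
Variables (F : finFieldType) (K : closedFieldType) (iota : {rmorphism F -> K}).
Variables (P : 'rV[F]_3) (r : 'rV[K]_3).

Definition above_P (v : 'rV[K]_3) : bool := (v == map_mx iota P)%MS.

Definition above_R (v : 'rV[K]_3) : bool :=
  [exists i : 'I_4, (v == iter i (@frobenius F K) r)%MS].

Definition on_Y (y : blowup_point K) : Prop :=
  match y with
  | Off v => [/\ v != 0, ~~ above_P v & ~~ above_R v]
  | Exc v w => (above_P v || above_R v) /\ row_free (col_mx v w)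
  end.

Definition rational_point (y : blowup_point F) : Prop :=
  on_Y (map_point iota y).

Definition enumerates_rational_points (n : nat) (y : 'I_n -> blowup_point F) :
    Prop :=
  [/\ forall i, rational_point (y i),
      forall i j, same_point (y i) (y j) -> i = j
    & forall z, rational_point z -> exists i, same_point z (y i)].

(* The line bundle O_Y(d H - e E - f F_R), that is pi^*O(d) twisted by         *)
(* - e E - f F_R.  Its rational sections are the quotients s = a / b of forms  *)
(* over F with deg a = deg b + d.  [germ d e f y s c] says that s is regular   *)
(* at y as a section of this bundle, with value c in its fibre at y:           *)
(* - if y = Off v, then s = a / b with b (v) <> 0 and c = a (v) / b (v);       *)
(* - if y = Exc v w lies above P (take k = e) or R (take k = f), then s is in  *)
(*   the local ring at y times t ^ k, with t a local equation of the           *)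
(*   exceptional curve.  In the blow-up chart (t, u) |-> v + t (w + u w'),     *)
(*   a fraction is in the local ring at y when it is A / B with B (y) <> 0;    *)
(*   multiplying A and B by t ^ m turns them into forms a and b, with b        *)
(*   vanishing at v to order m and its degree m part nonzero in direction w.   *)
(* The fibre is identified with K by the choice of the vectors v and w.        *)
Definition germ (d e f : nat) (y : blowup_point K)
    (s : {fraction {mpoly F[3]}}) (c : K) : Prop :=
  exists (g : nat) (a b : {mpoly F[3]}),
    [/\ a \is (g + d).-homog, b \is g.-homog, b != 0,
        s = tofrac a / tofrac b
      & match y with
        | Off v =>
            value_at iota v b != 0 /\
            c = value_at iota v a / value_at iota v b
        | Exc v w =>
            let k := if above_P v then e else f in
            exists m,
              [/\ vanishes_to_order iota m v b, expansion_at iota m v w b != 0,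
                  vanishes_to_order iota (m + k) v a
                & c = expansion_at iota (m + k) v w a
                        / expansion_at iota m v w b]
        end].

Definition global_section (d e f : nat) (s : {fraction {mpoly F[3]}}) : Prop :=
  forall y, on_Y y -> exists c, germ d e f y s c.

(* The code of evaluations of global sections at the rational points y i,      *)
(* where the coordinate on the fibre at y i is taken with respect to the basis *)
(* vector u i.                                                                 *)
Definition evaluation_code (d e f n : nat) (y : 'I_n -> blowup_point F)
    (u : 'I_n -> F) (c : 'rV[F]_n) : Prop :=
  exists s, global_section d e f s /\
    forall i, germ d e f (map_point iota (y i)) s (iota (c 0 i * u i)).

(* The line bundle F_4 of the system pi^*Lambda_4 - 2 E - F_R, whose members   *)
(* pi^*C - 2 E - F_R, for C a quartic in Lambda_4, are all equivalent to       *)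
(* 4 H - 2 E - F_R.                                                            *)
Definition code_F4 (n : nat) (y : 'I_n -> blowup_point F) (u : 'I_n -> F) :
    'rV[F]_n -> Prop :=
  evaluation_code 4 2 1 y u.

End Surface.

Section Codes.
Variables (F : finFieldType) (n : nat).
Implicit Type C : 'rV[F]_n -> Prop.

Definition hamming_distance (x y : 'rV[F]_n) : nat :=
  #|[set i | x 0 i != y 0 i]|.

Definition has_dimension C (k : nat) : Prop :=
  exists G : 'M[F]_(k, n), row_free G /\ forall c, C c <-> (c <= G)%MS.

Definition has_minimum_distance C (d : nat) : Prop :=
  (exists x y, [/\ C x, C y, x != y & hamming_distance x y = d]) /\
  (forall x y, C x -> C y -> x != y -> (d <= hamming_distance x y)%N).

End Codes.

(* Main.v *)
Require Import Defs.
From HB Require Import structures.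
From mathcomp Require Import all_boot all_order all_algebra all_field.
From mathcomp Require Import pgroup abelian mpoly ring zify.

Set Implicit Arguments.
Unset Strict Implicit.
Unset Printing Implicit Defensive.

Import GRing.Theory.
Local Open Scope ring_scope.

(** In coordinates where P is the point x = y = 0, a quartic with a double point
    at P is z^2 A(x, y) + z B(x, y) + C(x, y), with A, B, C binary forms of
    degrees 2, 3, 4.  Lines through P make Y into a family of fibres over the
    projective line of directions (x : y); on the fibre over d the quartic is a
    polynomial of degree at most 2 in z, and the point at infinity of the fibre
    is the point of E in direction d, where the section takes the value A(d).
    No point of R is rational, so the rational points of Y are the cells of a
    grid: one of the q + 1 rational directions and one of the q + 1 rational
    points of its fibre ([grid_enumeration]).  This gives the length.

    The line l has a direction alpha of degree 2 over F, with norm form M, and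
    the two points of R on l are the roots zeta, zeta^(q^2) of an irreducible
    polynomial over F_(q^2), which can be written z^2 + L(alpha) z + N(alpha)
    with binary forms L, N over F of degrees 1, 2.  Vanishing at R forces B - A L
    and C - A N to vanish at alpha, hence to be divisible by M, and the quartic is
      A (z^2 + L z + N) + M (z B1 + C2),  deg A = deg C2 = 2,  deg B1 = 1,
    which has 3 + 2 + 3 = 8 coefficients ([quartic_normal_form]).  A nonzero
    section of this shape vanishes identically on at most two fibres, and at most
    twice on every other fibre, so evaluation is injective ([value_inj]).

    A section with at most one full fibre has at most (q + 1) + 2 (q + 1) zeros.
    With two full fibres, dividing by their equations leaves, up to a
    scalar, either M or a member z^2 + L z + N + t M of the pencil of conics
    through R.  Such a conic contains no rational line, because zeta is not in F_(q^2), so it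
    has at most q + 1 points ([conic_card_le]); again there are at most 3 q + 3
    zeros ([zeros_le]).  As M has no rational zero, every pair (d, z) lies on
    exactly one conic of the pencil; so each of the q conics has exactly q + 1
    points.  For q > 2 there are more than q pairs of a conic and a rational line
    through P which do not meet ([sum_empty_fibre]), so some conic misses two of
    these lines, and its product with them has 3 q + 3 zeros ([maximal_zeros]).
    The minimum distance is (q + 1)^2 - (3 q + 3) = q^2 - q - 2.

    It remains to see that a global section is given by a quartic.  It is a
    fraction a / b, and b may be taken nonzero at a rational point other than P.
    Divide a by b with respect to the coordinate of that point.  On a general
    line through the point, local regularity forces the restriction of b to divide
    that of a, so the remainder vanishes on that line; it vanishes on almost every
    such line, hence is zero ([regular_fraction_is_polynomial]). *)

(** * Polynomials over an algebraically closed field *)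

Section ClosedFields.
Variable K : closedFieldType.

Lemma closed_field_fresh (s : seq K) : exists x, x \notin s.
Proof.
pose p : {poly K} := \prod_(a <- s) ('X - a%:P).
have nzp : p != 0 by rewrite monic_neq0 ?monic_prod_XsubC.
have /closed_rootP[x] : size ('X * p + 1 : {poly K}) != 1%N.
  rewrite mulrC size_polyDl size_mulX ?size_poly1 ?ltnS ?size_poly_gt0 //.
  by rewrite eqSS size_poly_eq0.
rewrite rootE !hornerE => /eqP px; exists x; apply/negP => xs.
have /eqP p0 : root p x by rewrite /p root_prod_XsubC.
by move/eqP: px; rewrite p0 mulr0 add0r oner_eq0.
Qed.

Lemma poly_eq0_of_roots (p : {poly K}) : (forall x, p.[x] = 0) -> p = 0.
Proof.
move=> p0; apply/eqP; apply: contraT => nzp.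
have [s us ss] : exists2 s : seq K, uniq s & size s = size p.
  elim: (size p) => [|k [s us <-]]; first by exists [::].
  have [z zs] := closed_field_fresh s.
  by exists (z :: s); rewrite //= zs us.
have: (size s < size p)%N.
  by apply: max_poly_roots us => //; apply/allP => z _; rewrite rootE p0.
by rewrite ss ltnn.
Qed.

(** With b = d g and p = e g, where g is the gcd, every local denominator b' is
    divisible by d; a root of d would be a common zero of all of them. *)
Lemma dvdp_of_local_regularity (p b : {poly K}) : b != 0 ->
  (forall z, exists p' b', p * b' = p' * b /\ b'.[z] != 0) -> b %| p.
Proof.
move=> nzb loc; have nzg : gcdp b p != 0 by rewrite gcdp_eq0 negb_and nzb.
have bE : b %/ gcdp b p * gcdp b p = b by rewrite divpK ?dvdp_gcdl.
have pE : p %/ gcdp b p * gcdp b p = p by rewrite divpK ?dvdp_gcdr.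
have cop : coprimep (b %/ gcdp b p) (p %/ gcdp b p).
  by rewrite coprimep_div_gcd ?nzb.
set d := b %/ gcdp b p in bE cop; set e := p %/ gcdp b p in pE cop.
have [sz_d|/closed_rootP[z dz]] := eqVneq (size d) 1%N.
  rewrite -[X in _ %| X]pE -[X in X %| _]bE dvdp_mul2r //.
  by move/eqP: sz_d; rewrite size_poly_eq1 => /eqp_dvdl ->; apply: dvd1p.
have [p' [b' [eqpb /negP[]]]] := loc z.
rewrite -/(root b' z) -dvdp_XsubCl; apply: dvdp_trans (_ : d %| _).
  by rewrite dvdp_XsubCl.
rewrite -(Gauss_dvdpr _ cop) -(dvdp_mul2r _ _ nzg) mulrAC pE eqpb.
by rewrite bE dvdp_mulIr.
Qed.

(** Kronecker substitution: at the points (x, x^N, x^(N^2)), with N larger than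
    all exponents, distinct monomials become distinct powers of x. *)
Lemma mpoly_eq0_of_eval (p : {mpoly K[3]}) :
  (forall v : 'rV[K]_3, p.@[fun j => v 0 j] = 0) -> p = 0.
Proof.
move=> p0; pose N := msize p.
pose d0 : 'I_3 := inord 0; pose d1 : 'I_3 := inord 1; pose d2 : 'I_3 := inord 2.
pose e (m : 'X_{1..3}) := (m d0 + N * (m d1 + N * m d2))%N.
have small m : m \in msupp p -> forall i, (m i < N)%N.
  move=> /msize_mdeg_lt lt i; apply: leq_ltn_trans lt.
  by rewrite mdegE (bigD1 i) //= leq_addr.
have digits a b c a' b' c' : (a < N -> a' < N -> b < N -> b' < N ->
    a + N * (b + N * c) = a' + N * (b' + N * c') -> [/\ a = a', b = b' & c = c'])%N.
  have dig u v u' v' : (u < N -> u' < N -> u + N * v = u' + N * v' -> u = u' /\ v = v')%N.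
    move=> uN u'N; rewrite ![(N * _)%N]mulnC ![(_ + _ * N)%N]addnC => E.
    have N0 : (0 < N)%N by apply: leq_ltn_trans uN.
    have := congr1 (modn^~ N) E; have := congr1 (divn^~ N) E.
    by rewrite !modnMDl !divnMDl // !divn_small // !addn0 !modn_small.
  by move=> aN a'N bN b'N /dig[]// -> /dig[]// -> ->.
have e_inj : {in msupp p &, injective e}.
  move=> m m' /small sm /small sm' /digits[]// E0 E1 E2.
  apply/mnmP => -[[|[|[|//]]] i3].
  - by have -> : Ordinal i3 = d0 by apply: val_inj; rewrite /= inordK.
  - by have -> : Ordinal i3 = d1 by apply: val_inj; rewrite /= inordK.
  - by have -> : Ordinal i3 = d2 by apply: val_inj; rewrite /= inordK.
pose P : {poly K} := \sum_(m <- msupp p) p@_m *: 'X^(e m).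
have P0 : P = 0.
  apply: poly_eq0_of_roots => x.
  rewrite -[RHS](p0 (\row_(j < 3) x ^+ (N ^ j))) mevalE horner_sum.
  apply: eq_bigr => m _; rewrite hornerZ hornerXn; congr (_ * _).
  rewrite /e !big_ord_recr /= big_ord0 mul1r !mxE -!exprM -!exprD /=.
  congr (_ ^+ _); rewrite !mulnDr /= expn0 mul1n expn1 mulnA addnA.
  by congr (m _ + N * m _ + N * N * m _)%N; apply: val_inj; rewrite /= inordK.
apply/mpolyP => m; rewrite mcoeff0; apply/eqP; apply: contraT.
rewrite -mcoeff_msupp => mp; suff /eqP : p@_m = 0 by rewrite mcoeff_eq0 mp.
have := congr1 (fun q : {poly K} => q`_(e m)) P0; rewrite coef0 coef_sum.
rewrite (bigD1_seq m) ?msupp_uniq //= coefZ coefXn eqxx mulr1 big1_seq.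
  by rewrite addr0 => ->.
move=> m' /andP[nm m'p]; rewrite coefZ coefXn; case: eqP => [/e_inj E|]; last by rewrite mulr0.
by rewrite E ?eqxx in nm.
Qed.
End ClosedFields.

(** * Restriction of forms to parametrized lines *)

Lemma mpoly_rmorph_ext (n : nat) (R S : comNzRingType)
    (f g : {rmorphism {mpoly R[n]} -> S}) :
  (forall c, f c%:MP = g c%:MP) -> (forall j, f 'X_j = g 'X_j) -> f =1 g.
Proof.
move=> fgC fgX p; rewrite [p]mpolyE !rmorph_sum; apply: eq_bigr => m _.
rewrite -mul_mpolyC !rmorphM fgC mpolyXE_id !rmorph_prod.
by congr (_ * _); apply: eq_bigr => j _; rewrite !rmorphXn fgX.
Qed.

Section LineRestriction.
Variables (F : finFieldType) (K : closedFieldType) (iota : {rmorphism F -> K}).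
Implicit Types (p a b : {mpoly F[3]}) (v w : 'rV[K]_3).

(** The restriction of a form to the line t |-> v + t w.  Everything about the
    local expansions of a form at v is read off these univariate polynomials. *)
Definition line_restriction v w : {mpoly F[3]} -> {poly K} :=
  mmap (polyC \o iota) (fun j => (v 0 j)%:P + (w 0 j) *: 'X).

HB.instance Definition _ v w :=
  GRing.RMorphism.copy (line_restriction v w) (line_restriction v w).

HB.instance Definition _ v :=
  GRing.RMorphism.copy (value_at iota v)
    (meval (fun j => v 0 j) \o map_mpoly iota).

Lemma value_atX v j : value_at iota v 'X_j = v 0 j.
Proof. by rewrite /value_at map_mpolyX mevalXU. Qed.

Lemma value_atC v c : value_at iota v c%:MP = iota c.
Proof. by rewrite /value_at map_mpolyC mevalC. Qed.

Lemma line_restrictionX v w j :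
  line_restriction v w 'X_j = (v 0 j)%:P + (w 0 j) *: 'X.
Proof. by rewrite /line_restriction mmapX mmap1U. Qed.

Lemma line_restrictionC v w c : line_restriction v w c%:MP = (iota c)%:P.
Proof. by rewrite /line_restriction mmapC. Qed.

Lemma horner_line_restriction v w p t :
  (line_restriction v w p).[t] = value_at iota (v + t *: w) p.
Proof.
apply: (mpoly_rmorph_ext (f := horner_eval t \o line_restriction v w)) => [c|j] /=.
  by rewrite line_restrictionC value_atC /horner_eval hornerC.
by rewrite line_restrictionX value_atX /horner_eval !hornerE !mxE [t * _]mulrC.
Qed.

(** In the expansion at v, the degree i part contributes its value at w times the
    i-th power of the parameter. *)
Lemma coef_line_restriction i v w p :
  (line_restriction v w p)`_i = expansion_at iota i v w p.
Proof.
rewrite /expansion_at /expansion.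
set q := map_mpoly iota p \mPo _.
have -> : line_restriction v w p =
    \sum_(m <- msupp q) (q@_m * \prod_j (w 0 j) ^+ m j) *: 'X^(mdeg m).
  transitivity (mmap (polyC (R:=K)) (fun j => (w 0 j) *: 'X) q).
    rewrite {}/q; move: p.
    apply: (mpoly_rmorph_ext (g := mmap polyC (fun j => (w 0 j) *: 'X) \o
      comp_mpoly _ \o map_mpoly iota)) => [c|j] /=.
      by rewrite line_restrictionC map_mpolyC comp_mpolyC mmapC.
    rewrite line_restrictionX map_mpolyX comp_mpolyXU -tnth_nth tnth_mktuple.
    by rewrite rmorphD /= mmapX mmapC mmap1U addrC.
  apply: eq_bigr => m _; rewrite -mul_polyC polyCM -mulrA; congr (_ * _).
  rewrite /mmap1 mdegE -prodrXr rmorph_prod -big_split /=.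
  by apply: eq_bigr => j _; rewrite -mul_polyC exprMn rmorphXn.
rewrite coef_sum pihomogE raddf_sum /= [RHS]big_mkcond /=.
apply: eq_bigr => m _; rewrite coefZ coefXn eq_sym.
by case: eqP; rewrite ?mulr0 // mulr1 mevalZ mevalX.
Qed.

Lemma vanishes_to_orderP m v p :
  vanishes_to_order iota m v p <->
  (forall w i, (i < m)%N -> (line_restriction v w p)`_i = 0).
Proof.
split=> [p0 w i im | p0 i im].
  by rewrite coef_line_restriction /expansion_at p0 // meval0.
by apply: mpoly_eq0_of_eval => w; rewrite -[LHS]coef_line_restriction p0.
Qed.

End LineRestriction.

(** * Locally regular fractions are polynomials *)

Section Division.
Variables (n : nat) (k : fieldType) (j : 'I_n).
Implicit Types (p a b : {mpoly k[n]}) (m : 'X_{1..n}).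

(** A monomial of degree g whose j-th exponent is g is the pure power, so removing
    that power from a form of degree g leaves j-th exponents below g. *)
Lemma dhomog_sub_pure_power b g : b \is g.-homog ->
  {in msupp (b - b@_(U_(j) *+ g) *: 'X_[U_(j) *+ g]),
    forall m : 'X_{1..n}, (m j < g)%N}.
Proof.
move=> hb m; rewrite mcoeff_msupp mcoeffB mcoeffZ mcoeffX.
have [<-|nm] := eqVneq (U_(j) *+ g)%MM m; first by rewrite mulr1 subrr eqxx.
rewrite mulr0 subr0 -mcoeff_msupp => /(dhomog_mf hb) /= dm.
rewrite ltn_neqAle -{2}dm mdegE (bigD1 j) //= leq_addr andbT.
apply: contra nm => /eqP mj; apply/eqP/mnmP => i; rewrite mulmnE mnm1E.
have [<-|ni] := eqVneq j i; first by rewrite mul1n mj.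
apply/esym; rewrite mul0n; move: dm; rewrite mdegE (bigD1 j) //= mj.
rewrite (bigD1 i) 1?eq_sym //=; lia.
Qed.

(** Euclidean division by b with respect to the variable j: the pure power of that
    variable has an invertible coefficient in b, so it can be rewritten. *)
Lemma mpoly_division b g : b \is g.-homog -> b@_(U_(j) *+ g)%MM != 0 ->
  forall a, exists h r, a = b * h + r /\ {in msupp r, forall m, (m j < g)%N}.
Proof.
move=> hb nzb; pose c := b@_(U_(j) *+ g)%MM.
pose D a := exists h r, a = b * h + r /\ {in msupp r, forall m, (m j < g)%N}.
have D0 : D 0 by exists 0, 0; rewrite mulr0 addr0; split=> // m; rewrite msupp0.
have DD a1 a2 : D a1 -> D a2 -> D (a1 + a2).
  move=> [h1 [r1 [-> r1g]]] [h2 [r2 [-> r2g]]]; exists (h1 + h2), (r1 + r2).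
  split; first by rewrite mulrDr addrACA.
  by move=> m /msuppD_le; rewrite mem_cat => /orP[/r1g|/r2g].
have DZ x a : D a -> D (x *: a).
  move=> [h [r [-> rg]]]; exists (x *: h), (x *: r).
  split; first by rewrite scalerDr scalerAr.
  by move=> m /msuppZ_le /rg.
have Dsum a : {in msupp a, forall m, D 'X_[m]} -> D a.
  rewrite {2}[a]mpolyE => aD; rewrite big_seq.
  by elim/big_ind: _ => // m /aD /DZ.
pose b' := b - c *: 'X_[U_(j) *+ g].
have b'g := dhomog_sub_pure_power hb; rewrite -/c -/b' in b'g.
have DX N m : (m j < N)%N -> D 'X_[m].
  elim: N m => // N IH m; rewrite ltnS => mN.
  have [mg|gm] := ltnP (m j) g.
    exists 0, 'X_[m]; rewrite mulr0 add0r; split=> // m'.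
    by rewrite msuppX inE => /eqP->.
  have /submK mE : (U_(j) *+ g <= m)%MM.
    apply/mnm_lepP => i; rewrite mulmnE mnm1E.
    by case: eqP => [<-|]; rewrite ?mul1n.
  set m' := (m - _)%MM in mE.
  have -> : 'X_[m] = b * (c^-1 *: 'X_[m']) - c^-1 *: ('X_[m'] * b').
    rewrite -mE mpolyXD /b' mulrBr scalerBr -scalerAr [b * _]mulrC.
    by rewrite opprB addrC subrK -scalerAr scalerA mulVf // scale1r.
  apply: (DD); first by exists (c^-1 *: 'X_[m']), 0; rewrite addr0; split=> // ?; rewrite msupp0.
  rewrite -scaleNr; apply/DZ/Dsum => m'' /msuppM_le /allpairsP[[u v] /= [uX vb' ->]].
  apply: IH; move: uX; rewrite msuppX inE => /eqP->; rewrite mnmDE.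
  have := b'g _ vb'; have := congr1 (fun m : 'X_{1..n} => m j) mE.
  rewrite /= mnmDE mulmnE mnm1E eqxx mul1n; lia.
by move=> a; apply: Dsum => m _; apply: DX (ltnSn _).
Qed.

End Division.

Section Regularity.
Variables (F : finFieldType) (K : closedFieldType) (iota : {rmorphism F -> K}).
Variable j : 'I_3.
Implicit Types (p a b : {mpoly F[3]}) (v w : 'rV[K]_3).
(* The coordinate point of the variable j, the common point of the lines below. *)
Let eps : 'rV[K]_3 := delta_mx 0 j.

Lemma size_line_restriction_le v p g : {in msupp p, forall m : 'X_{1..3}, (m j < g)%N} ->
  (size (line_restriction iota v eps p) <= g)%N.
Proof.
move=> pg; rewrite [p]mpolyE rmorph_sum /= big_seq.
apply: leq_trans (size_sum _ _ _) _; apply/bigmax_leqP_seq => m _ mp.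
apply: leq_trans (pg m mp); rewrite -mul_mpolyC rmorphM /= line_restrictionC.
rewrite mul_polyC (leq_trans (size_scale_leq _ _)) // mpolyXE_id rmorph_prod.
rewrite (bigD1 j) //= rmorphXn /= line_restrictionX mxE !eqxx scale1r.
have [c ->] : exists c, \prod_(i < 3 | i != j)
    line_restriction iota v eps ('X_i ^+ m i) = c%:P.
  exists (\prod_(i < 3 | i != j) v 0 i ^+ m i); rewrite rmorph_prod.
  apply: eq_bigr => i /negbTE ij; rewrite !rmorphXn /= line_restrictionX mxE.
  by rewrite ij andbF scale0r addr0.
rewrite mulrC mul_polyC (leq_trans (size_scale_leq _ _)) //.
by rewrite addrC -[v 0 j]opprK polyCN size_exp_XsubC.
Qed.

Lemma size_line_restriction_monic v b g : b \is g.-homog ->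
  b@_(U_(j) *+ g)%MM != 0 -> size (line_restriction iota v eps b) = g.+1.
Proof.
move=> /(dhomog_sub_pure_power (j:=j)); set c := b@__; set b' := b - _ => b'g nzc.
have -> : b = c *: 'X_[U_(j) *+ g] + b' by rewrite addrC subrK.
have sX : size (line_restriction iota v eps (c *: 'X_[U_(j) *+ g])) = g.+1.
  rewrite -mul_mpolyC rmorphM /= line_restrictionC mul_polyC.
  rewrite size_scale ?fmorph_eq0 // -mpolyXn rmorphXn /= line_restrictionX mxE !eqxx scale1r.
  by rewrite addrC -[v 0 j]opprK polyCN size_exp_XsubC.
by rewrite rmorphD /= size_polyDl sX // ltnS size_line_restriction_le.
Qed.

Lemma value_at_eps b g : b \is g.-homog ->
  value_at iota eps b = iota (b@_(U_(j) *+ g)%MM).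
Proof.
move=> hb; have := dhomog_sub_pure_power (j := j) hb.
set c := b@__; set b' := b - _ => b'g.
have hb' : b' \is g.-homog.
  by rewrite /b' rpredB ?rpredZ ?dhomogX /= ?mdegMn ?mdeg1 ?mul1n.
have b'0 : value_at iota eps b' = 0.
  rewrite [b']mpolyE rmorph_sum /= big1_seq // => m /andP[_ mb'].
  have [i ij mi] : exists2 i, i != j & m i != 0%N.
    apply/exists_inP; apply: contraTT (b'g m mb') => /existsPn m0.
    rewrite -leqNgt -(dhomog_mf hb' mb') /= mdegE (bigD1 j) //= big1 ?addn0 //.
    by move=> i ij; have := m0 i; rewrite ij /= negbK => /eqP.
  rewrite -mul_mpolyC rmorphM /= mpolyXE_id rmorph_prod (bigD1 i) //=.
  by rewrite rmorphXn /= value_atX mxE (negbTE ij) andbF expr0n (negbTE mi) mul0r mulr0.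
rewrite -[X in value_at _ _ X](subrK (c *: 'X_[U_(j) *+ g]) b) -/b' rmorphD /= b'0 add0r.
rewrite -mul_mpolyC rmorphM /= value_atC -mpolyXn rmorphXn /= value_atX mxE.
by rewrite !eqxx expr1n mulr1.
Qed.

(** Lam cuts out the lines through eps that are to be avoided: it is a cone with
    vertex eps.  Along any other line v + t eps the divisor b keeps its degree g
    and, by local regularity, divides a; the remainder, of degree below g, is then
    zero on that line.  So the remainder times Lam vanishes everywhere. *)
Lemma regular_fraction_is_polynomial (Lam : {mpoly K[3]}) a b g :
  b \is g.-homog -> value_at iota eps b != 0 -> Lam != 0 ->
  (forall v t, Lam.@[fun i => (v + t *: eps) 0 i] = Lam.@[fun i => v 0 i]) ->
  (forall v, Lam.@[fun i => v 0 i] != 0 ->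
     exists a' b', a * b' = a' * b /\ value_at iota v b' != 0) ->
  exists h, a = b * h.
Proof.
move=> hb; rewrite (value_at_eps hb) fmorph_eq0 => nzb nzL invL reg.
have [h [r [aE rg]]] := mpoly_division hb nzb a.
exists h; suff r0 : r = 0 by rewrite aE r0 addr0.
suff : map_mpoly iota r * Lam = 0.
  move/eqP; rewrite mulf_eq0 (negbTE nzL) orbF => /eqP r0.
  apply/mpolyP => m; apply: (fmorph_inj iota).
  by rewrite -mcoeff_map_mpoly r0 !mcoeff0 rmorph0.
apply: mpoly_eq0_of_eval => v; rewrite mevalM.
have [->|Lv] := eqVneq (Lam.@[fun i => v 0 i]) 0; first by rewrite mulr0.
suff r0 : line_restriction iota v eps r = 0.
  rewrite -/(value_at iota v r) -[v]addr0 -[X in v + X](scale0r eps).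
  by rewrite -horner_line_restriction r0 horner0 mul0r.
have sb := size_line_restriction_monic v hb nzb.
have dvd : line_restriction iota v eps b %| line_restriction iota v eps r.
  rewrite -(dvdp_addr _ (dvdp_mulIl _ (line_restriction iota v eps h))).
  rewrite -rmorphM -rmorphD -aE; apply: dvdp_of_local_regularity.
    by rewrite -size_poly_eq0 sb.
  move=> z; have [|a' [b' [e nzb']]] := reg (v + z *: eps); first by rewrite invL.
  exists (line_restriction iota v eps a'), (line_restriction iota v eps b').
  by rewrite -!rmorphM e horner_line_restriction.
apply/eqP; apply: contraT => /dvdp_leq /(_ dvd).
by rewrite sb ltnNge size_line_restriction_le.
Qed.

End Regularity.

(** * The Frobenius of the base field *)

Section Frobenius.
Variables (F : finFieldType) (K : closedFieldType) (iota : {rmorphism F -> K}).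

(** The embedding is a dummy argument: it records the base field, on which
    additivity of this power map depends. *)
Definition frob of {rmorphism F -> K} : K -> K := fun x => x ^+ #|F|.
Local Notation phi := (frob iota).

Let pnat_card : [pchar K].-nat #|F|.
Proof.
have [p pr_p pF] := finPcharP F.
have pK : p \in [pchar K] by rewrite (fmorph_pchar iota).
rewrite (eq_pnat _ (pcharf_eq pK)) -cardsT.
exact: abelem_pgroup (fin_ring_pchar_abelem pF).
Qed.

Fact frob_zmod_morphism : zmod_morphism phi.
Proof.
by move=> x y; rewrite /frob; apply: (canRL (addrK _)); rewrite -exprDn_pchar ?subrK.
Qed.

Fact frob_monoid_morphism : monoid_morphism phi.
Proof. by split=> [|x y]; rewrite /frob ?expr1n ?exprMn. Qed.

HB.instance Definition _ := GRing.isZmodMorphism.Build K K phi frob_zmod_morphism.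
HB.instance Definition _ := GRing.isMonoidMorphism.Build K K phi frob_monoid_morphism.

Lemma frob_base a : phi (iota a) = iota a.
Proof. by rewrite /frob -rmorphXn expf_card. Qed.

Lemma frob_fixedP x : phi x = x -> exists a, x = iota a.
Proof.
rewrite /frob => xq; have : (map_poly iota ('X^#|F| - 'X)).[x] = 0.
  by rewrite rmorphB /= map_polyXn map_polyX !hornerE xq subrr.
rewrite finField_genPoly rmorph_prod /= horner_prod => /eqP.
move/prodf_eq0 => [a _]; rewrite rmorphB /= map_polyX map_polyC !hornerE subr_eq0.
by move/eqP=> ->; exists a.
Qed.

Lemma frobeniusE (v : 'rV[K]_3) : frobenius F v = map_mx phi v.
Proof. by []. Qed.

Lemma frobenius_base (u : 'rV[F]_3) :
  frobenius F (map_mx iota u) = map_mx iota u.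
Proof. by apply/rowP => j; rewrite frobeniusE !mxE frob_base. Qed.

Lemma value_at_frobenius (v : 'rV[K]_3) p :
  value_at iota (frobenius F v) p = phi (value_at iota v p).
Proof.
apply: (mpoly_rmorph_ext (g := phi \o value_at iota v)) => [c|j] /=.
  by rewrite !value_atC frob_base.
by rewrite !value_atX mxE.
Qed.

(** If a conjugate of r is a rational point, then so is r, because the Frobenius
    reflects equality of points; but r has degree 4. *)
Lemma rational_not_above_R (r : 'rV[K]_3) (u : 'rV[F]_3) :
  closed_point F 4 r -> ~~ above_R F r (map_mx iota u).
Proof.
case=> _ _ /(_ 1 isT) /= Nr; apply: contra Nr => /existsP[[i _] /= ur].
suff : (iter i (@frobenius F K) (frobenius F r) == iter i (@frobenius F K) r)%MS.
  by elim: i {ur} => //= i IH; rewrite !frobeniusE !map_submx => /IH.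
rewrite -iterSr iterS; have := ur.
rewrite -(map_submx (frob iota)) -(map_submx (frob iota) (iter _ _ _)).
rewrite -!frobeniusE frobenius_base => /andP[a1 a2]; case/andP: ur => b1 b2.
by rewrite (submx_trans a2 b1) (submx_trans b2 a1).
Qed.

End Frobenius.

(** * Germs and global sections *)

Lemma dhomog_quotient (n g d : nat) (k : fieldType) (b h : {mpoly k[n]}) :
  b != 0 -> b \is g.-homog -> b * h \is (g + d).-homog -> h \is d.-homog.
Proof.
move=> nzb hb hbh; pose H i := pihomog mdeg i h.
pose N := maxn (msize h) d.+1.
have hE : h = \sum_(i < N) H i by apply: pihomog_partitionE; rewrite leq_maxl.
have dN : (d < N)%N by rewrite leq_maxr.
have bhE : b * h = b * H d.
  rewrite -{1}(pihomog_dE hbh) {1}hE mulr_sumr raddf_sum /=.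
  have hom i : b * H i \is (g + i).-homog by apply/dhomogM/pihomogP.
  rewrite (bigD1 (Ordinal dN)) //= pihomog_dE // big1 ?addr0 // => i nid.
  by rewrite (pihomog_ne0 _ (hom i)) // eqn_add2l.
by rewrite (mulfI nzb bhE); apply: pihomogP.
Qed.

Lemma ord3_cycle (j : 'I_3) :
  [/\ j + 1 != j, j + 2 != j, j + 1 != j + 2 &
    forall i, [\/ i = j, i = j + 1 | i = j + 2]].
Proof.
have jD x : (j + x == j) = (x == 0) by rewrite -{2}[j]addr0 (inj_eq (addrI j)).
split; rewrite ?jD ?(inj_eq (addrI j)) //.
move=> i; rewrite -[i](subrK j) addrC; case: (i - j) => -[|[|[|//]]] ltm3.
- by apply: Or31; rewrite -[RHS]addr0; congr (_ + _); apply: val_inj.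
- by apply: Or32; congr (_ + _); apply: val_inj.
- by apply: Or33; congr (_ + _); apply: val_inj.
Qed.

Lemma coef0_factor (R : nzRingType) (p : {poly R}) m :
  (forall i, (i < m)%N -> p`_i = 0) ->
  exists2 p0, p = p0 * 'X^m & forall i, p0`_i = p`_(i + m).
Proof.
move=> p0; exists (drop_poly m p) => [|i]; last by rewrite coef_drop_poly.
rewrite -{1}[p](poly_take_drop m) [take_poly m p](_ : _ = 0) ?add0r //.
by apply/polyP => i; rewrite coef_take_poly coef0; case: ltnP => // /p0.
Qed.

Section Germs.
Variables (F : finFieldType) (K : closedFieldType) (iota : {rmorphism F -> K}).
Variables (P : 'rV[F]_3) (r : 'rV[K]_3).
Implicit Types (h a b : {mpoly F[3]}) (v w : 'rV[K]_3).

Lemma tofrac_eq_div h a b : b != 0 ->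
  (tofrac h = tofrac a / tofrac b) <-> a = b * h.
Proof.
move=> nzb; have nzfb : tofrac b != 0 by rewrite tofrac_eq0.
split=> [hE | ->]; last by rewrite tofracM mulrC mulKf.
by apply/eqP; rewrite -tofrac_eq tofracM hE mulrC divfK.
Qed.

Lemma germ_Off d e f v h c :
  germ iota P d e f (Off v) (tofrac h) c -> c = value_at iota v h.
Proof.
case=> g [a [b [_ _ nzb /tofrac_eq_div-/(_ nzb) -> [nzbv ->]]]].
by rewrite rmorphM /= mulrC mulKf.
Qed.

(** Along the line v + t w, b is t^m times a series with nonzero constant term and
    a = b h is divisible by t^(m + k); so t^k divides h. *)
Lemma germ_Exc d e f v w h c (k := if above_P iota P v then e else f) :
  germ iota P d e f (Exc v w) (tofrac h) c ->
  (forall i, (i < k)%N -> expansion_at iota i v w h = 0) /\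
  c = expansion_at iota k v w h.
Proof.
case=> g [a [b [_ _ nzb /tofrac_eq_div-/(_ nzb) aE [m]]]]; rewrite -/k.
rewrite -!coef_line_restriction.
case=> /vanishes_to_orderP/(_ w)/coef0_factor[B BE BC] nzB.
move=> /vanishes_to_orderP/(_ w)/coef0_factor[A AE AC] ->.
set H := line_restriction iota v w h.
have HB : H * B = A * 'X^k.
  apply: (mulIf (_ : 'X^m != 0)); first by rewrite monic_neq0 ?monicXn.
  by rewrite -mulrA -BE -mulrA -exprD addnC -AE aE rmorphM mulrC.
have nzB0 : B`_0 != 0 by rewrite BC add0n.
have H0 i : (i < k)%N -> H`_i = 0.
  elim/ltn_ind: i => i IH ik; have := congr1 (fun p : {poly K} => p`_i) HB.
  rewrite coefMXn ik coefM big_ord_recr /= subnn big1 ?add0r => [/eqP|j _].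
    by rewrite mulf_eq0 (negbTE nzB0) orbF => /eqP.
  by rewrite IH ?mul0r // (ltn_trans _ ik).
split=> [i /H0 <-|]; first by rewrite -coef_line_restriction.
have := congr1 (fun p : {poly K} => p`_k) HB.
rewrite /= coefMXn ltnn subnn coefM big_ord_recr /= subnn big1 ?add0r => [|j _].
  rewrite AC BC !add0n addnC => <-; rewrite mulfK // -(add0n m) -BC //.
by rewrite H0 ?mul0r.
Qed.

Lemma germ_tofrac d e f y h : h \is d.-homog ->
  match y with
  | Off v => True
  | Exc v w =>
      vanishes_to_order iota (if above_P iota P v then e else f) v h
  end ->
  germ iota P d e f y (tofrac h)
    match y with
    | Off v => value_at iota v h
    | Exc v w => expansion_at iota (if above_P iota P v then e else f) v w h
    end.
Proof.
move=> hh van; exists 0, h, 1; rewrite tofrac1 divr1 oner_neq0 dhomog1; split=> //.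
case: y van => [v _|v w van]; first by rewrite rmorph1 divr1 oner_neq0.
exists 0; rewrite add0n; have E1 : expansion_at iota 0 v w 1 = 1.
  by rewrite -coef_line_restriction rmorph1 coef1.
by rewrite E1 divr1 oner_neq0; split.
Qed.

Lemma row_eq_scale (k : fieldType) n (v c : 'rV[k]_n) : v != 0 -> (v == c)%MS ->
  exists2 x, x != 0 & v = x *: c.
Proof.
move=> nzv /andP[/sub_rVP[x vE] _]; exists x => //; apply: contra nzv => /eqP x0.
by rewrite vE x0 scale0r.
Qed.

Lemma scale_row_eq (k : fieldType) n (v : 'rV[k]_n) (x : k) :
  x != 0 -> (x *: v == v)%MS.
Proof. by move=> nzx; apply/eqmxP/eqmx_scale. Qed.

Lemma iter_frobenius_neq0 i : r != 0 -> iter i (@frobenius F K) r != 0.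
Proof.
by move=> nzr; elim: i => //= i IH; rewrite (frobeniusE iota) map_mx_eq0.
Qed.

Hypotheses (hP : P != 0) (hr : closed_point F 4 r).

(** Of the first two coordinate points at least one is not P; at that point the
    denominator b is nonzero.  The lines to avoid join it to P and to the four
    conjugates of r. *)
Lemma global_section_polynomial d e f s :
  global_section iota P r d e f s -> exists2 h, h \is d.-homog & s = tofrac h.
Proof.
move=> reg.
have [j nPj] : exists j : 'I_3, ~~ (map_mx iota (delta_mx (0 : 'I_1) j) == map_mx iota P)%MS.
  have [P0|] := boolP (delta_mx (0 : 'I_1) (0 : 'I_3) == P)%MS; last first.
    by exists 0; rewrite !(map_submx iota).
  have [P1|] := boolP (delta_mx (0 : 'I_1) (1 : 'I_3) == P)%MS; last first.
    by exists 1; rewrite !(map_submx iota).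
  case/andP: P0 => s0 s0'; case/andP: P1 => s1 s1'.
  have /sub_rVP[x /rowP/(_ 0)] := submx_trans s0 s1'.
  by rewrite !mxE /= mulr0 => /eqP; rewrite oner_eq0.
pose eps : 'rV[K]_3 := delta_mx 0 j.
have epsE : eps = map_mx iota (delta_mx 0 j) by rewrite map_delta_mx.
have [|c0 [g [a [b [ha hb nzb sE [nzbe _]]]]]] := reg (Off eps).
  split; rewrite ?epsE ?rational_not_above_R //.
  rewrite -epsE; apply/eqP => /rowP/(_ j)/eqP; rewrite !mxE !eqxx oner_eq0 //.
pose centers := map_mx iota P :: [seq iter (i : 'I_4) (@frobenius F K) r | i : 'I_4].
(* The equation of the line through eps and c. *)
pose ell (c : 'rV[K]_3) : {mpoly K[3]} :=
  c 0 (j + 2) *: 'X_(j + 1) - c 0 (j + 1) *: 'X_(j + 2).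
have ellE c v : (ell c).@[fun i => v 0 i] =
    c 0 (j + 2) * v 0 (j + 1) - c 0 (j + 1) * v 0 (j + 2).
  by rewrite /ell mevalB !mevalZ !mevalXU.
have [j1 j2 j12 jall] := ord3_cycle j.
have centerP c : c \in centers -> c != 0 /\ ~~ (eps == c)%MS.
  rewrite inE => /orP[/eqP->|/mapP[i _ ->]].
    by split; [rewrite map_mx_eq0 | rewrite epsE].
  split; first by apply: iter_frobenius_neq0; case: hr.
  rewrite epsE; apply: contra (rational_not_above_R iota (delta_mx 0 j) hr).
  by move=> e_r; apply/existsP; exists i.
have nz_ell c : c \in centers -> ell c != 0.
  move=> /centerP[nzc nce]; apply: contra nce => /eqP ell0.
  have cE (v : 'rV[K]_3) : c 0 (j + 2) * v 0 (j + 1) = c 0 (j + 1) * v 0 (j + 2).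
    by apply/eqP; rewrite -subr_eq0 -ellE ell0 meval0.
  have c2 : c 0 (j + 2) = 0.
    by have := cE (delta_mx 0 (j + 1)); rewrite !mxE !eqxx eq_sym (negbTE j12) mulr1 mulr0.
  have c1 : c 0 (j + 1) = 0.
    by have := cE (delta_mx 0 (j + 2)); rewrite !mxE !eqxx (negbTE j12) mulr1 mulr0.
  have cE' : c = c 0 j *: eps.
    apply/rowP => i; rewrite !mxE eqxx /=; have [->|->|->] := jall i.
    - by rewrite eqxx mulr1.
    - by rewrite c1; case: eqP => [<-|_]; rewrite ?c1 ?mulr0 ?mul0r.
    - by rewrite c2; case: eqP => [<-|_]; rewrite ?c2 ?mulr0 ?mul0r.
  have nzcj : c 0 j != 0 by apply: contra nzc => /eqP cj; rewrite cE' cj scale0r.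
  by rewrite cE'; apply/eqmxP/eqmx_sym/eqmx_scale.
pose Lam := \prod_(c <- centers) ell c.
have [|v t|v nzL|h aE] := @regular_fraction_is_polynomial _ _ iota j Lam a b g hb nzbe.
- by rewrite /Lam prodf_seq_neq0; apply/allP => c /nz_ell.
- rewrite /Lam !rmorph_prod; apply: eq_bigr => c _ /=; rewrite !ellE !mxE.
  by rewrite (negbTE j1) (negbTE j2) !andbF mulr0 !addr0.
- have off c : c \in centers -> forall x, v != x *: c.
    move=> cc x; apply: contra nzL => /eqP ->.
    rewrite /Lam rmorph_prod prodf_seq_eq0; apply/hasP; exists c => //=.
    by rewrite ellE !mxE; apply/eqP; ring.
  have [|c [g' [a' [b' [_ _ nzb' sE' [nzb'v _]]]]]] := reg (Off v).
    have nzv : v != 0 by rewrite -(scale0r (map_mx iota P)) off // mem_head.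
    split=> //.
      apply/negP => /(row_eq_scale nzv)[x _ vE].
      by have := off (map_mx iota P) (mem_head _ _) x; rewrite -vE eqxx.
    apply/existsP => -[i /(row_eq_scale nzv)[x _ vE]].
    have := off (iter i (@frobenius F K) r) _ x; rewrite -vE eqxx => /(_ _)/negP; case=> //.
    by rewrite inE; apply/orP; right; apply/mapP; exists i; rewrite ?mem_enum.
  exists a', b'; split=> //.
  apply/eqP; rewrite -tofrac_eq !tofracM.
  have : tofrac a / tofrac b = tofrac a' / tofrac b' by rewrite -sE.
  by move/eqP; rewrite eqr_div ?tofrac_eq0.
exists h; first by apply: (dhomog_quotient nzb hb); rewrite -aE.
by rewrite sE; apply/esym/tofrac_eq_div.
Qed.

End Germs.

(** * Binary quadratic forms over a finite field *)

Section ProjectiveLine.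
Variable F : finFieldType.

(** [option F] is the rational projective line: [Some a] is (a : 1) and [None] is
    (1 : 0). *)
Definition px (d : option F) : F := if d is Some a then a else 1.
Definition py (d : option F) : F := if d is Some _ then 1 else 0.

Lemma cross_eq0 d d' : (px d * py d' - py d * px d' == 0) = (d == d').
Proof.
case: d d' => [a|] [a'|] /=; rewrite ?mulr1 ?mulr0 ?mul1r ?mul0r ?subrr ?subr0 ?sub0r ?eqxx //.
- by rewrite subr_eq0; apply/eqP/eqP => [->|[->]].
- by rewrite oppr_eq0 oner_eq0.
- by rewrite oner_eq0.
Qed.

Lemma linear_form_eq0 a b d d' : d != d' ->
  a * px d + b * py d = 0 -> a * px d' + b * py d' = 0 -> a = 0 /\ b = 0.
Proof.
rewrite -cross_eq0 => nz e e'; split; apply: (mulIf nz); rewrite mul0r.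
  have -> : a * (px d * py d' - py d * px d') =
    (a * px d + b * py d) * py d' - (a * px d' + b * py d') * py d by ring.
  by rewrite e e' !mul0r subrr.
have -> : b * (px d * py d' - py d * px d') =
    (a * px d' + b * py d') * px d - (a * px d + b * py d) * px d' by ring.
by rewrite e e' !mul0r subrr.
Qed.

Definition quad (a b c x y : F) := a * x ^+ 2 + b * (x * y) + c * y ^+ 2.

Lemma quad_zeros_le a b c : [|| a != 0, b != 0 | c != 0] ->
  (#|[set d | quad a b c (px d) (py d) == 0%R]| <= 2)%N.
Proof.
move=> nz; pose p : {poly F} := Poly [:: c; b; a].
have nzp : p != 0.
  apply: contraTneq nz => /polyP p0; rewrite !negb_or !negbK.
  have := p0 0; have := p0 1; have := p0 2; rewrite !coef_Poly !coef0 /= => -> -> ->.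
  by rewrite eqxx.
have rootsE x : (quad a b c x 1 == 0) = root p x.
  rewrite rootE horner_Poly /= /quad; congr (_ == _); ring.
set S := [set d | _].
have SE : S \subset (if a == 0 then [set None] else set0) :|: Some @: [set x | root p x].
  apply/subsetP => -[x|]; rewrite !inE /=.
    by rewrite rootsE => rx; rewrite imset_f ?inE ?orbT.
  rewrite /quad expr1n !mulr0 mulr1 expr0n /= mulr0 !addr0 => ->.
  by rewrite inE.
apply: leq_trans (subset_leq_card SE) _; apply: leq_trans (leq_card_setU _ _).1 _.
rewrite card_imset; last by move=> x y [].
have: (#|[set x | root p x]| < size p)%N.
  rewrite cardE; apply: max_poly_roots => //; last exact: enum_uniq.
  by apply/allP => x; rewrite mem_enum inE.
move=> lt; have [a0|_] := eqVneq a 0; last first.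
  by rewrite cards0 add0n -ltnS (leq_trans lt) // size_Poly.
rewrite cards1 add1n (leq_trans lt) //.
by apply/leq_sizeP => -[|[|[|j]]] // _; rewrite coef_Poly //= nth_default.
Qed.

Lemma quad_eq0_of_zeros a b c (S : {set option F}) : (2 < #|S|)%N ->
  (forall d, d \in S -> quad a b c (px d) (py d) = 0) -> [/\ a = 0, b = 0 & c = 0].
Proof.
move=> S3 S0; have : ~~ [|| a != 0, b != 0 | c != 0].
  apply/negP => /quad_zeros_le; rewrite leqNgt => /negP[]; apply: leq_trans S3 _.
  by apply/subset_leq_card/subsetP => d /S0; rewrite inE => ->.
by rewrite !negb_or !negbK => /and3P[/eqP-> /eqP-> /eqP->].
Qed.

Lemma exists_direction_notin (S : {set option F}) : (#|S| <= 2)%N -> exists d, d \notin S.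
Proof.
move=> S2; apply/existsP; apply: contraT => /existsPn inS.
have : ([set: option F] \subset S) by apply/subsetP => d _; have := inS d; rewrite negbK.
move/subset_leq_card; rewrite cardsT card_option => /leq_trans/(_ S2).
by rewrite ltnNge finNzRing_gt1.
Qed.

(** At a third point d3 the first form is nonzero, and the combination of the two
    forms that vanishes there has three zeros. *)
Lemma quad_proportional a b c a' b' c' d1 d2 :
  d1 != d2 -> [|| a != 0, b != 0 | c != 0] ->
  (forall d, d \in [set d1; d2] -> quad a b c (px d) (py d) = 0) ->
  (forall d, d \in [set d1; d2] -> quad a' b' c' (px d) (py d) = 0) ->
  exists t, [/\ a' = t * a, b' = t * b & c' = t * c].
Proof.
move=> d12 nz z z'.
have [|d3 nd3] := @exists_direction_notin [set d1; d2]; first by rewrite cards2 d12.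
have S3 : (2 < #|d3 |: [set d1; d2]|)%N by rewrite cardsU1 nd3 cards2 d12.
pose Q := quad a b c (px d3) (py d3); pose Q' := quad a' b' c' (px d3) (py d3).
have nzQ : Q != 0.
  apply: contraTneq nz => Q0; have [|-> -> ->] := @quad_eq0_of_zeros a b c _ S3.
    by move=> d; rewrite in_setU1 => /orP[/eqP->|/z].
  by rewrite eqxx.
exists (Q' / Q).
have [|/eqP + /eqP + /eqP] := @quad_eq0_of_zeros (a' - Q' / Q * a) (b' - Q' / Q * b) (c' - Q' / Q * c) _ S3.
  move=> d; have -> : quad (a' - Q' / Q * a) (b' - Q' / Q * b) (c' - Q' / Q * c) (px d) (py d)
    = quad a' b' c' (px d) (py d) - Q' / Q * quad a b c (px d) (py d) by rewrite /quad; ring.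
  rewrite in_setU1 => /orP[/eqP->|dS]; first by rewrite -/Q -/Q' divfK ?subrr.
  by rewrite z // z' // mulr0 subrr.
by rewrite !subr_eq0 => /eqP-> /eqP-> /eqP->.
Qed.

End ProjectiveLine.

(** * Conics without rational lines *)

Section Conics.
Variables (F : finFieldType) (L1 L2 n1 n2 n3 : F).

Definition conic x y z := z ^+ 2 + (L1 * x + L2 * y) * z + quad n1 n2 n3 x y.
(** The polarization of [conic], written out so that it makes sense in
    characteristic 2. *)
Definition polar x y z x' y' z' :=
  z * z' *+ 2 + (L1 * x + L2 * y) * z' + (L1 * x' + L2 * y') * z +
  n1 * (x * x') *+ 2 + n2 * (x * y' + y * x') + n3 * (y * y') *+ 2.

(* Two points on the conic with vanishing polar span a line on the conic. *)
Hypothesis no_line : forall x y z x' y' z', x * y' - y * x' != 0 ->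
  conic x y z = 0 -> conic x' y' z' = 0 -> polar x y z x' y' z' = 0 -> False.

Lemma conic_fibre d z z' :
  conic (px d) (py d) z = 0 -> conic (px d) (py d) z' = 0 -> z != z' ->
  z + z' + (L1 * px d + L2 * py d) = 0.
Proof.
move=> e e' nz; apply: (mulfI (_ : z - z' != 0)); first by rewrite subr_eq0.
by rewrite mulr0 -[RHS](subrr 0) -{1}e -e' /conic; ring.
Qed.

(** Fix a point p of the conic.  The linear form b = polar(p, .) vanishes at no
    other point v of the conic, for otherwise the line pv would lie on it.  The
    vectors v / b(v), modulo p, lie on an affine line of the plane F^3 / p with q
    points, and they determine v: if v / b(v) - v' / b(v') is a multiple of p, then
    expanding the quadratic form on it gives polar(v, v') = 0. *)
Lemma conic_card_le :
  (#|[set v : option F * F | conic (px v.1) (py v.1) v.2 == 0%R]| <= #|F| + 1)%N.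
Proof.
set S := [set v | _]; have [->|[[d0 z0]]] := set_0Vmem S; first by rewrite cards0.
rewrite inE /= => /eqP p0.
pose b (v : option F * F) := polar (px d0) (py d0) z0 (px v.1) (py v.1) v.2.
have nzb v : v \in S -> v != (d0, z0) -> b v != 0.
  case: v => d z; rewrite inE /= => /eqP v0 nv; apply/eqP => b0.
  have [dd|nd] := eqVneq d0 d; last first.
    by apply: no_line p0 v0 b0; rewrite cross_eq0.
  have nz : z != z0 by move: nv; rewrite dd; apply: contraNneq => ->.
  rewrite -dd in v0 b0; have e := conic_fibre v0 p0 nz.
  have: (z - z0) * (z0 *+ 2 + (L1 * px d0 + L2 * py d0)) = 0.
    transitivity (polar (px d0) (py d0) z0 (px d0) (py d0) z -
        conic (px d0) (py d0) z0 *+ 2); last first.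
      by rewrite -[polar _ _ _ _ _ _]/(b (d0, z)) b0 p0 mul0rn subrr.
    by rewrite /polar /conic /quad; ring.
  move/eqP; rewrite mulf_eq0 subr_eq0 (negbTE nz) /= => /eqP e2.
  have: z - z0 = (z + z0 + (L1 * px d0 + L2 * py d0)) -
      (z0 *+ 2 + (L1 * px d0 + L2 * py d0)) by ring.
  by rewrite e e2 subrr => /eqP; rewrite subr_eq0 (negbTE nz).
(* s1 and s2 are coordinates on F^3 / p, in which b = be1 s1 + be2 s2; one of them
   suffices on the affine line b = 1. *)
pose s1 (v : option F * F) := px v.1 * py d0 - py v.1 * px d0.
pose s2 (v : option F * F) := v.2 - z0 * (if d0 is Some _ then py v.1 else px v.1).
pose be2 := z0 *+ 2 + (L1 * px d0 + L2 * py d0).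
pose g v := if v == (d0, z0) then None else Some ((if be2 == 0 then s2 v else s1 v) / b v).
have -> : (#|F| + 1 = #|{: option F}|)%N by rewrite card_option addn1.
rewrite -(card_in_imset (f := g)) ?max_card // => v v' vS v'S; rewrite /g.
have [->|nv] := eqVneq v _; have [->|nv'] := eqVneq v' _ => // -[e].
have bn := nzb v vS nv; have bn' := nzb v' v'S nv'.
have [be1 bE] : exists be1, forall v, b v = be1 * s1 v + be2 * s2 v.
  rewrite /b /s1 /s2 /be2 {b s1 s2 be2 g e bn bn' nzb}.
  case: d0 p0 {nv nv'} => [a|] /= p0.
    exists (L1 * z0 + n1 * a *+ 2 + n2) => u.
    transitivity ((L1 * z0 + n1 * a *+ 2 + n2) * (px u.1 * 1 - py u.1 * a) +
      (z0 *+ 2 + (L1 * a + L2 * 1)) * (u.2 - z0 * py u.1) + conic a 1 z0 * py u.1 *+ 2).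
      by rewrite /polar /conic /quad; ring.
    by rewrite p0 mul0r mul0rn addr0.
  exists (- (L2 * z0 + n2)) => u.
  transitivity (- (L2 * z0 + n2) * (px u.1 * 0 - py u.1 * 1) +
    (z0 *+ 2 + (L1 * 1 + L2 * 0)) * (u.2 - z0 * px u.1) + conic 1 0 z0 * px u.1 *+ 2).
    by rewrite /polar /conic /quad; ring.
  by rewrite p0 mul0r mul0rn addr0.
have [e1 e2] : s1 v * b v' = s1 v' * b v /\ s2 v * b v' = s2 v' * b v.
  move: e => /eqP; rewrite eqr_div //; have [be0|nbe] := eqVneq be2 0 => /eqP e.
    by split=> //; rewrite !bE be0 !mul0r !addr0; ring.
  split=> //; apply: (mulfI nbe); apply/eqP; rewrite -subr_eq0; apply/eqP.
  transitivity (be1 * (s1 v' * b v - s1 v * b v')); last by rewrite e subrr mulr0.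
  by rewrite !bE; ring.
(* Two points of the same fibre: if it is the fibre of p, both are the second
   root; otherwise s1 compares the normalizations. *)
have [dd|nd] := eqVneq v.1 v'.1.
  suff zz : v.2 = v'.2 by rewrite [v]surjective_pairing dd zz -surjective_pairing.
  have s1E : s1 v = s1 v' by rewrite /s1 dd.
  have [s10|ns1] := eqVneq (s1 v) 0.
    have d0E u : s1 u = 0 -> u.1 = d0 by move/eqP; rewrite cross_eq0 => /eqP.
    have fib u : u \in S -> u != (d0, z0) -> s1 u = 0 ->
        u.2 + z0 + (L1 * px d0 + L2 * py d0) = 0.
      case: u => d z; rewrite inE /= => /eqP u0 nu /d0E /= dE; subst d.
      by apply: conic_fibre => //; apply: contraNneq nu => ->.
    apply: (addIr z0); apply: (addIr (L1 * px d0 + L2 * py d0)).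
    by rewrite !fib // -s1E.
  have bb : b v = b v' by apply: (mulfI ns1); rewrite e1 s1E.
  have : s2 v = s2 v' by apply: (mulIf bn'); rewrite e2 bb.
  by rewrite /s2 dd; apply: addIr.
exfalso; move: vS v'S; rewrite !inE => /eqP v0 /eqP v'0.
apply: (no_line _ v0 v'0); first by rewrite cross_eq0.
(* The vector b(v') v - b(v) v', a multiple of p. *)
pose w f := b v' * f v - b v * f v' : F.
have w0 : conic (w (fun u => px u.1)) (w (fun u => py u.1)) (w snd) = 0.
  have s1w : w s1 = 0 by rewrite /w [X in X - _]mulrC e1 mulrC subrr.
  have s2w : w s2 = 0 by rewrite /w [X in X - _]mulrC e2 mulrC subrr.
  have [k [-> -> ->]] : exists k, [/\ w (fun u => px u.1) = k * px d0,
      w (fun u => py u.1) = k * py d0 & w snd = k * z0].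
    rewrite /w /s1 /s2 in s1w s2w *; case: (d0) s1w s2w => [a|] /= s1w s2w.
      exists (w (fun u => py u.1)); rewrite /w mulr1; split=> //; apply/eqP;
        rewrite -subr_eq0; apply/eqP; [rewrite -s1w | rewrite -s2w]; ring.
    exists (w (fun u => px u.1)); rewrite /w mulr1 mulr0; split=> //.
      by apply: oppr_inj; rewrite oppr0 -[RHS]s1w; ring.
    by apply/eqP; rewrite -subr_eq0; apply/eqP; rewrite -[RHS]s2w; ring.
  transitivity (k ^+ 2 * conic (px d0) (py d0) z0); last by rewrite p0 mulr0.
  by rewrite /conic /quad; ring.
apply: (mulfI bn); apply: (mulfI bn'); rewrite !mulr0.
transitivity (b v' ^+ 2 * conic (px v.1) (py v.1) v.2 +
  b v ^+ 2 * conic (px v'.1) (py v'.1) v'.2 -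
  conic (w (fun u => px u.1)) (w (fun u => py u.1)) (w snd)).
  by rewrite /w /conic /polar /quad; ring.
by rewrite v0 v'0 w0 !mulr0 addr0 subrr.
Qed.
End Conics.

(** * Counting zeros on the grid *)

Lemma card_fibres (A B : finType) (S : {set A * B}) :
  #|S| = (\sum_a #|[set b | (a, b) \in S]|)%N.
Proof.
rewrite -sum1_card (eq_bigr (fun v => if v \in S then 1 else 0)%N); last by move=> v ->.
rewrite big_mkcond /= (eq_bigr (fun v : A * B => if (v.1, v.2) \in S then 1 else 0)%N).
  rewrite -(pair_bigA _ (fun a b => if (a, b) \in S then 1 else 0)%N) /=.
  by apply: eq_bigr => a _; rewrite -big_mkcond /= sum1dep_card.
by move=> [a b] _ /=; case: ((a, b) \in S).
Qed.

(** A (z^2 + L z w + N w^2) + M (B1 z w + C2 w^2), where w homogenizes the fibre: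
    w = 1 gives the quartic, and z = 1, w = 0 its value on E.  It is stated over
    any ring, to be used for numbers, forms and restrictions to lines alike.
    The coefficients 0-2 are those of A, 3-4 of B1 and 5-7 of C2. *)
Definition section_form (R : comNzRingType) (L1 L2 N1 N2 m1 m2 : R)
    (c : 'I_8 -> R) (x y z w : R) : R :=
  (c (inord 0) * x ^+ 2 + c (inord 1) * (x * y) + c (inord 2) * y ^+ 2) *
    (z ^+ 2 + (L1 * x + L2 * y) * (z * w) + (N1 * (x * y) + N2 * y ^+ 2) * w ^+ 2) +
  (x ^+ 2 + m1 * (x * y) + m2 * y ^+ 2) *
    ((c (inord 3) * x + c (inord 4) * y) * (z * w) +
     (c (inord 5) * x ^+ 2 + c (inord 6) * (x * y) + c (inord 7) * y ^+ 2) * w ^+ 2).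

Section Counting.
Variables (F : finFieldType) (L1 L2 N1 N2 m1 m2 : F).
Local Notation q := #|F|.
Local Notation conic_at t := (conic L1 L2 t (N1 + t * m1) (N2 + t * m2)).

Hypothesis norm_neq0 : forall d : option F, quad 1 m1 m2 (px d) (py d) != 0.
Hypothesis no_line : forall t x y z x' y' z', x * y' - y * x' != 0 ->
  conic_at t x y z = 0 -> conic_at t x' y' z' = 0 ->
  polar L1 L2 t (N1 + t * m1) (N2 + t * m2) x y z x' y' z' = 0 -> False.

Definition value (c : 'rV[F]_8) (v : option F * option F) : F :=
  section_form L1 L2 N1 N2 m1 m2 (c 0) (px v.1) (py v.1) (px v.2) (py v.2).

Definition zeros c := [set v | value c v == 0].

(* The forms A, B1, C2, M, L, N at the direction d. *)
Let qA (c : 'rV[F]_8) d := quad (c 0 (inord 0)) (c 0 (inord 1)) (c 0 (inord 2)) (px d) (py d).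
Let lB (c : 'rV[F]_8) d := c 0 (inord 3) * px d + c 0 (inord 4) * py d.
Let qC (c : 'rV[F]_8) d := quad (c 0 (inord 5)) (c 0 (inord 6)) (c 0 (inord 7)) (px d) (py d).
Let M d := quad 1 m1 m2 (px d) (py d).
Let L d := L1 * px d + L2 * py d.
Let N d := N1 * (px d * py d) + N2 * py d ^+ 2.

Lemma valueE c d e : value c (d, e) =
  quad (qA c d) (qA c d * L d + M d * lB c d) (qA c d * N d + M d * qC c d) (px e) (py e).
Proof. by rewrite /value /section_form /qA /lB /qC /M /L /N /quad /=; ring. Qed.

Lemma row8_eq0 (c : 'rV[F]_8) : (forall k, (k < 8)%N -> c 0 (inord k) = 0) -> c = 0.
Proof. by move=> c0; apply/rowP => k; rewrite mxE -[k]inord_val c0. Qed.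

Definition full_fibres c := [set d | [&& qA c d == 0, lB c d == 0 & qC c d == 0]].

(** One of A, C2, B1 is a nonzero form of degree at most 2; the linear form B1 is
    multiplied by x, to reuse the bound for quadratic forms. *)
Lemma full_fibres_le c : c != 0 -> (#|full_fibres c| <= 2)%N.
Proof.
move=> nzc.
have sub f : (forall d, d \in full_fibres c -> f d == 0) ->
    (#|[set d | f d == 0%R]| <= 2)%N -> (#|full_fibres c| <= 2)%N.
  by move=> f0; apply/leq_trans/subset_leq_card/subsetP => d /f0; rewrite inE.
have inD d : d \in full_fibres c -> [/\ qA c d == 0, lB c d == 0 & qC c d == 0].
  by rewrite inE => /and3P.
have [/quad_zeros_le|nA] := boolP [|| c 0 (inord 0) != 0, c 0 (inord 1) != 0 | c 0 (inord 2) != 0].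
  by apply: sub => d /inD[].
have [/quad_zeros_le|nC] := boolP [|| c 0 (inord 5) != 0, c 0 (inord 6) != 0 | c 0 (inord 7) != 0].
  by apply: sub => d /inD[].
have [/quad_zeros_le|nB] := boolP [|| c 0 (inord 3) != 0, c 0 (inord 4) != 0 | (0 : F) != 0].
  apply: sub => d /inD[_ /eqP lB0 _]; have -> : quad (c 0 (inord 3)) (c 0 (inord 4)) 0
      (px d) (py d) = px d * lB c d by rewrite /quad /lB; ring.
  by rewrite lB0 mulr0.
case/eqP: nzc; apply: row8_eq0.
move: nA nB nC; rewrite !negb_or !negbK => /and3P[/eqP A0 /eqP A1 /eqP A2].
move=> /and3P[/eqP B0 /eqP B1 _] /and3P[/eqP C0 /eqP C1 /eqP C2].
by do 8!case=> //.
Qed.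

Lemma fibre_zeros_le c d : d \notin full_fibres c ->
  (#|[set e | value c (d, e) == 0%R]| <= 2)%N.
Proof.
rewrite inE => nd.
rewrite (eq_card (B := [set e | quad (qA c d) (qA c d * L d + M d * lB c d)
  (qA c d * N d + M d * qC c d) (px e) (py e) == 0])); last by move=> e; rewrite !inE valueE.
apply: quad_zeros_le; apply: contraR nd; rewrite !negb_or !negbK => /and3P[/eqP-> ].
by rewrite !mul0r !add0r !mulf_eq0 !(negbTE (norm_neq0 d)) eqxx /= => -> ->.
Qed.

Lemma value_inj c : (forall v, value c v = 0) -> c = 0.
Proof.
move=> c0; apply/eqP; apply: contraT => nzc.
have [d nd] := exists_direction_notin (full_fibres_le nzc).
have [e] := exists_direction_notin (fibre_zeros_le nd).
by rewrite inE c0 eqxx.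
Qed.

Lemma conic_at_card_le t :
  (#|[set v : option F * F | conic_at t (px v.1) (py v.1) v.2 == 0%R]| <= q + 1)%N.
Proof. exact/conic_card_le/no_line. Qed.

(** With two full fibres, B1 is zero and, if A is not, C2 = t A: what remains of the
    section is A (d) times the conic of parameter t.  If A is zero, all other zeros
    are on E. *)
Lemma zeros_le c : c != 0 -> (#|zeros c| <= 3 * q + 3)%N.
Proof.
move=> nzc; set D := full_fibres c; have D2 := full_fibres_le nzc.
rewrite -(cardsID (setX D [set: option F]) (zeros c)).
have : (#|zeros c :&: setX D [set: option F]| <= #|D| * q.+1)%N.
  by rewrite (leq_trans (subset_leq_card (subsetIr _ _))) // cardsX cardsT card_option.
set m := #|_ :&: _|; set m' := #|_ :\: _| => mle.
have m'le : (m' <= 2 * q.+1)%N.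
  rewrite /m' card_fibres -card_option -sum1_card big_distrr /=; apply: leq_sum => d _.
  rewrite muln1; have [dD|dD] := boolP (d \in D).
    by rewrite (_ : [set _ | _] = set0) ?cards0 //; apply/setP => e; rewrite in_set in_setD in_setX dD !inE.
  rewrite (leq_trans _ (fibre_zeros_le dD)) //; apply/subset_leq_card/subsetP => e.
  by rewrite in_set in_setD => /andP[_]; rewrite !inE.
have [D1|D3] := leqP #|D| 1.
  rewrite (leq_trans (leq_add mle m'le)) // -mulnDl.
  by rewrite (leq_trans (leq_mul (leq_add D1 (leqnn 2)) (leqnn _))) // mulnS addnC.
have /cards2P[d1 [d2 [d12 DE]]] : #|D| == 2%N by rewrite eqn_leq D2.
suff m'q : (m' <= q + 1)%N.
  rewrite (leq_trans (leq_add mle m'q)) // (leq_trans (leq_add (leq_mul D2 (leqnn _)) (leqnn _))) //.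
  by lia.
have inD d : d \in [set d1; d2] -> [/\ qA c d = 0, lB c d = 0 & qC c d = 0].
  by rewrite -DE inE => /and3P[/eqP ? /eqP ? /eqP].
have [B3 B4] : c 0 (inord 3) = 0 /\ c 0 (inord 4) = 0.
  by apply: (linear_form_eq0 d12); [case: (inD d1); rewrite ?set21 | case: (inD d2); rewrite ?set22].
have lB0 d : lB c d = 0 by rewrite /lB B3 B4 !mul0r addr0.
have [nA|nA] := boolP [|| c 0 (inord 0) != 0, c 0 (inord 1) != 0 | c 0 (inord 2) != 0].
  have [||t [C5 C6 C7]] := @quad_proportional F _ _ _ (c 0 (inord 5)) (c 0 (inord 6)) (c 0 (inord 7)) _ _ d12 nA.
  - by move=> d /inD[].
  - by move=> d /inD[].
  have qCE d : qC c d = t * qA c d by rewrite /qC C5 C6 C7 /qA /quad; ring.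
  apply: leq_trans (conic_at_card_le t); rewrite -(card_imset _ (f := fun v => (v.1, Some v.2))).
    apply/subset_leq_card/subsetP => -[d e]; rewrite !inE /= andbT lB0 qCE eqxx valueE lB0 qCE.
    move=> /andP[nd]; have nzA : qA c d != 0.
      by apply: contra nd => /eqP->; rewrite mulr0 eqxx.
    case: e => [z|] z0; last by move: z0; rewrite /quad /= !expr0n expr1n /= !mulr0 mulr1 !addr0 (negbTE nzA).
    apply/imsetP; exists (d, z) => //; rewrite inE /=.
    rewrite -(inj_eq (mulfI nzA)) mulr0 -(eqP z0); apply/eqP.
    by rewrite /conic /quad /M /L /N /quad /=; ring.
  by move=> [d z] [d' z'] [/= -> ->].
have A0 d : qA c d = 0.
  by move: nA; rewrite !negb_or !negbK /qA => /and3P[/eqP-> /eqP-> /eqP->]; rewrite /quad !mul0r !addr0.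
rewrite addn1 -card_option -(card_imset _ (f := fun d : option F => (d, None : option F))).
  apply/subset_leq_card/subsetP => -[d e]; rewrite !inE /= andbT A0 lB0 eqxx valueE A0 lB0 /=.
  move=> /andP[nd]; case: e => [z|] => [|_]; last by apply/imsetP; exists d.
  have -> : quad 0 (0 * L d + M d * 0) (0 * N d + M d * qC c d) z 1 = M d * qC c d.
    by rewrite /quad; ring.
  by rewrite mulf_eq0 (negbTE nd) (negbTE (norm_neq0 d)).
by move=> d d' [].
Qed.

Let empty_fibre t d := [forall z, conic_at t (px d) (py d) z != 0].

Lemma conic_atE t d z :
  conic_at t (px d) (py d) z = z ^+ 2 + L d * z + N d + t * M d.
Proof. by rewrite /conic /quad /L /N /M /quad; ring. Qed.

(** The conic through (d, z) has parameter g(z), where g is invariant under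
    z |-> - L(d) - z.  So the values of g are taken twice, except at fixed points of
    this involution, and the parameters that are not values are those wanted. *)
Lemma empty_fibre_card d :
  (q <= 2 * #|[set t | empty_fibre t d]| + #|[set z : F | (z *+ 2 + L d == 0)%R]|)%N.
Proof.
pose g z := - (z ^+ 2 + L d * z + N d) / M d.
have nzM : M d != 0 := norm_neq0 d.
have gE t z : (conic_at t (px d) (py d) z == 0) = (g z == t).
  by rewrite conic_atE addrC addr_eq0 -[RHS](inj_eq (mulIf nzM)) /g divfK // eq_sym.
have gsym z : g (- L d - z) = g z by rewrite /g; congr (- _ / _); ring.
set Fix := [set z : F | _].
have fib t : t \in g @: [set: F] ->
    (2 <= \sum_(z in [set: F] | g z == t) (1 + (z \in Fix)))%N.
  case/imsetP => z0 _ ->; rewrite (bigD1 z0) ?in_setT ?eqxx //=.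
  have [_|nFix] := boolP (z0 \in Fix); first by rewrite leq_addr.
  have nz : - L d - z0 != z0.
    by apply: contra nFix => /eqP e; rewrite inE mulr2n -{1}e; apply/eqP; ring.
  by rewrite (bigD1 (- L d - z0)) /= ?in_setT ?gsym ?eqxx ?nz // addnA addn0 leq_add.
have : (2 * #|g @: [set: F]| <= q + #|Fix|)%N.
  have tot : (\sum_(z in [set: F]) (1 + (z \in Fix)) = q + #|Fix|)%N.
    rewrite big_split /= sum1_card cardsT; congr addn.
    rewrite -sum1_card big_mkcond [RHS]big_mkcond /=; apply: eq_bigr => z _.
    by rewrite in_setT; case: (z \in Fix).
  rewrite -tot (partition_big_imset g) -sum1_card big_distrr /=.
  by apply: leq_sum => t /fib; rewrite muln1.
have -> : [set t | empty_fibre t d] = ~: (g @: [set: F]).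
  apply/setP => t; rewrite !inE; apply/forallP/negP => [nt /imsetP[z _ tE]|nt z].
    by have := nt z; rewrite gE tE eqxx.
  by rewrite gE; apply: contra_notN nt => /eqP <-; apply: imset_f.
move: #|Fix| (cardsC (g @: [set: F])) => k; move: #|_| #|~: _| #|F| => a b q'; lia.
Qed.

(* Otherwise, in characteristic 2, every line through P would be tangent to every
   conic of the pencil. *)
Hypothesis separable : 2%:R = 0 :> F -> (L1 != 0) || (L2 != 0).

(** In characteristic 2 the involution has no fixed point on a fibre where L is
    nonzero, and L has at most one zero: at least q fibres are each missed by q / 2
    conics.  Otherwise there is one fixed point on each fibre: q + 1 fibres are each
    missed by (q - 1) / 2 conics.  Both counts exceed q when q > 2. *)
Lemma sum_empty_fibre : (2 < q)%N -> (q < \sum_d #|[set t | empty_fibre t d]|)%N.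
Proof.
move=> q3; have [two0|two] := eqVneq (2%:R : F) 0.
  pose D := [set d | L d == 0].
  have D1 : (#|D| <= 1)%N.
    rewrite leqNgt; apply/negP => /card_gt1P[d [d' [dD d'D dd']]].
    have := separable two0; move: dD d'D; rewrite !inE => /eqP dD /eqP d'D.
    have [||-> ->] := linear_form_eq0 dd' (a := L1) (b := L2).
    - exact: dD.
    - exact: d'D.
    - by rewrite eqxx.
  have lower d : ((d \notin D) * q <= 2 * #|[set t | empty_fibre t d]|)%N.
    rewrite inE; have [//|nL] := eqVneq (L d) 0; rewrite mul1n.
    rewrite (leq_trans (empty_fibre_card d)) // [X in (_ + X)%N](_ : _ = 0%N) ?addn0 //.
    apply/eqP; rewrite cards_eq0; apply/eqP/setP => z; rewrite !inE.
    by rewrite -mulr_natr two0 mulr0 add0r (negbTE nL).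
  rewrite -(ltn_pmul2l (isT : 0 < 2)%N) big_distrr /=.
  apply: (@leq_trans (\sum_d (d \notin D) * q)); last by apply: leq_sum => d _; apply: lower.
  have -> : (\sum_d (d \notin D) * q = #|~: D| * q)%N.
    rewrite -big_distrl /=; congr muln; rewrite -sum1_card [RHS]big_mkcond /=.
    by apply: eq_bigr => d _; rewrite in_setC; case: (_ \notin _).
  have := cardsC D; rewrite card_option; move: D1 q3; clear; move: #|D| #|~: D| #|F| => a b p; nia.
have lower d : (q - 1 <= 2 * #|[set t | empty_fibre t d]|)%N.
  have := empty_fibre_card d; have : (#|[set z : F | (z *+ 2 + L d == 0)%R]| <= 1)%N.
    rewrite leqNgt; apply/negP => /card_gt1P[z [z' []]]; rewrite !inE => /eqP e /eqP e' /eqP[].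
    apply: (mulIf two); rewrite !mulr_natr; apply: (addIr (L d)); by rewrite e e'.
  lia.
rewrite -(ltn_pmul2l (isT : 0 < 2)%N) big_distrr /=.
apply: (@leq_trans (\sum_(d : option F) (q - 1))); last by apply: leq_sum => d _; apply: lower.
by rewrite sum_nat_const card_option; case: #|F| q3 => [|[|[|k]]] // _; rewrite subn1 /=; lia.
Qed.

(** Each of the q (q + 1) pairs (d, z) is on one of the q conics, since M(d) is
    nonzero; none of them has more than q + 1 points, so all have that number. *)
Lemma conic_at_card t :
  #|[set v : option F * F | conic_at t (px v.1) (py v.1) v.2 == 0%R]| = (q + 1)%N.
Proof.
pose S t := [set v : option F * F | conic_at t (px v.1) (py v.1) v.2 == 0].
have total : (\sum_t #|S t| = \sum_(t : F) (q + 1))%N.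
  rewrite sum_nat_const.
  transitivity (\sum_(v : option F * F) 1)%N; last first.
    by rewrite sum1_card card_prod card_option addn1 mulnC.
  under eq_bigr do rewrite -sum1dep_card big_mkcond /=.
  rewrite exchange_big /=; apply: eq_bigr => -[d z] _ /=.
  rewrite -big_mkcond /= sum1dep_card; apply/eqP/cards1P.
  exists (- (z ^+ 2 + L d * z + N d) / M d); apply/setP => t'; rewrite !inE conic_atE.
  by rewrite addrC addr_eq0 -[RHS](inj_eq (mulIf (norm_neq0 d))) divfK ?norm_neq0.
apply/eqP; rewrite eqn_leq conic_at_card_le /=.
have rest : (\sum_(t' | t' != t) #|S t'| <= \sum_(t' : F | t' != t) (q + 1))%N.
  by apply: leq_sum => t' _; apply: conic_at_card_le.
move: total; rewrite (bigD1 t) //= [RHS](bigD1 t) //= => total.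
by rewrite -(leq_add2r (\sum_(t' : F | t' != t) (q + 1))) -total leq_add2l.
Qed.

Lemma maximal_zeros : (2 < q)%N -> exists2 c, c != 0 & #|zeros c| = (3 * q + 3)%N.
Proof.
move=> q3.
have [t [d1 [d2 [d1t d2t d12]]]] : exists t d1 d2,
    [/\ empty_fibre t d1, empty_fibre t d2 & d1 != d2].
  have [t /card_gt1P[d1 [d2 [d1t d2t d12]]]] : exists t, (1 < #|[set d | empty_fibre t d]|)%N.
    apply/existsP; apply: contraT => /existsPn le1.
    have := sum_empty_fibre q3; rewrite ltnNge => /negP[].
    under eq_bigr do rewrite -sum1dep_card big_mkcond /=.
    rewrite exchange_big /= -[q]sum1_card; apply: leq_sum => t _.
    by rewrite -big_mkcond /= sum1dep_card leqNgt le1.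
  by exists t, d1, d2; rewrite !inE in d1t d2t.
(* The product of the equations of the directions d1 and d2. *)
pose s := [:: py d1 * py d2; - (py d1 * px d2 + px d1 * py d2); px d1 * px d2].
pose c : 'rV[F]_8 := \row_k (s ++ [:: 0; 0] ++ map ( *%R t) s)`_k.
pose ll d := (px d * py d1 - py d * px d1) * (px d * py d2 - py d * px d2).
have cE k : (k < 8)%N -> c 0 (inord k) = (s ++ [:: 0; 0] ++ map ( *%R t) s)`_k.
  by move=> k8; rewrite mxE inordK.
have llE d : (ll d == 0) = (d \in [set d1; d2]) by rewrite mulf_eq0 !cross_eq0 !inE.
have vE d e : value c (d, e) = ll d * (px e ^+ 2 + L d * (px e * py e) + N d * py e ^+ 2 + t * M d * py e ^+ 2).
  by rewrite /value /section_form !cE //= /ll /L /N /M /quad; ring.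
have zE : zeros c = setX [set d1; d2] [set: option F] :|:
    (fun v => (v.1, Some v.2)) @: [set v : option F * F | conic_at t (px v.1) (py v.1) v.2 == 0].
  apply/setP => -[d e]; rewrite inE vE mulf_eq0 llE [RHS]in_setU in_setX in_setT andbT; congr (_ || _).
  case: e => [z|] /=; last first.
    rewrite !expr0n expr1n /= !mulr0 !addr0 oner_eq0; apply/esym/negbTE/imsetP => -[//].
  rewrite !expr1n !mulr1; apply/idP/imsetP => [z0|[[d' z'] ]].
    by exists (d, z) => //; rewrite inE conic_atE.
  by rewrite inE conic_atE /= => z0 [-> ->].
have nz : #|zeros c| = (3 * q + 3)%N.
  rewrite zE cardsU (_ : _ :&: _ = set0) ?cards0 ?subn0; last first.
    apply/setP => -[d e]; rewrite in_setI in_setX in_setT andbT in_set0.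
    apply/negbTE/negP => /andP[d12' /imsetP[[d' z]]]; rewrite inE /= => z0 [dE _].
    move: d12'; rewrite !inE => /orP[]/eqP dd; move: z0; rewrite -dE dd.
      by rewrite (negbTE (forallP d1t z)).
    by rewrite (negbTE (forallP d2t z)).
  rewrite cardsX cards2 d12 cardsT card_option card_imset.
    by rewrite conic_at_card; move: #|F| => p /=; lia.
  by move=> [d z] [d' z'] [/= -> ->].
exists c => //; apply: contra_eq_neq nz => ->.
have -> : zeros 0 = [set: option F * option F].
  by apply/setP => -[d e]; rewrite !inE /value /section_form !mxE; apply/eqP; ring.
rewrite cardsT card_prod card_option; move: #|F| q3 => p p3; apply/eqP; nia.
Qed.

End Counting.

(** * Coordinates adapted to the point P *)

Lemma exists_unitmx_first_row (k : fieldType) (P : 'rV[k]_3) : P != 0 ->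
  exists2 T : 'M[k]_3, T \in unitmx & row 0 T = P.
Proof.
move=> nzP; pose c := col_ebase P 0 0; pose T := row_ebase P.
have PE : P = c *: row 0 T.
  rewrite -{1}[P]mulmx_ebase rank_rV nzP [col_ebase P]mx11_scalar -mulmxA mul_scalar_mx.
  congr (_ *: _); apply/rowP => j; rewrite !mxE (bigD1 0) //= big1 => [|i ni].
    by rewrite !mxE /= mul1r addr0.
  by rewrite !mxE; case: i ni => -[|i] //= lt3 _; rewrite mul0r.
have nzc : c != 0 by apply: contra nzP => /eqP c0; rewrite PE c0 scale0r.
by exists (c *: T); rewrite ?unitmxZ ?unitfE ?row_ebase_unit // linearZ /= -PE.
Qed.

Lemma ternary_formE (k : fieldType) (d : nat) (h : {mpoly k[3]}) :
  h \is d.-homog -> exists C : nat -> nat -> k,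
  h = \sum_(a < d.+1) \sum_(b < d.+1 - a)
        C a b *: ('X_0 ^+ (d - a - b) * 'X_1 ^+ a * 'X_(2 : 'I_3) ^+ b).
Proof.
move=> hh; pose mn a b := (U_(0%R : 'I_3) *+ (d - a - b) + U_(1%R : 'I_3) *+ a + U_(2%R : 'I_3) *+ b)%MM.
exists (fun a b => h@_(mn a b)).
have mnE a b : [/\ mn a b 0 = (d - a - b)%N, mn a b 1 = a & mn a b (2 : 'I_3) = b].
  by rewrite /mn !mnmDE !mulmnE !mnm1E /= !mul0n !mul1n !addn0 !add0n.
have mdegE3 (m : 'X_{1..3}) : mdeg m = (m 0%R + m 1%R + m (2%R : 'I_3))%N.
  rewrite mdegE !big_ord_recr big_ord0 /= add0n.
  by congr (m _ + m _ + m _)%N; apply: val_inj.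
have mnP m : mdeg m = d -> m = mn (m 1) (m (2 : 'I_3)).
  rewrite mdegE3 => dE; have [e0 e1 e2] := mnE (m 1) (m (2 : 'I_3)).
  apply/mnmP => -[[|[|[|//]]] lt3].
  - by rewrite (_ : Ordinal lt3 = 0) ?e0 -?dE; [lia | apply: val_inj].
  - by rewrite (_ : Ordinal lt3 = 1) ?e1 //; apply: val_inj.
  - by rewrite (_ : Ordinal lt3 = (2 : 'I_3)) ?e2 //; apply: val_inj.
have XE a b : 'X_0 ^+ (d - a - b) * 'X_1 ^+ a * 'X_(2 : 'I_3) ^+ b = 'X_[k, mn a b].
  by rewrite /mn !mpolyXD !mpolyXn.
apply/mpolyP => m; under eq_bigr do under eq_bigr do rewrite XE.
rewrite raddf_sum /=; under eq_bigr do rewrite raddf_sum /=.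
under eq_bigr do under eq_bigr do rewrite mcoeffZ mcoeffX.
have [dm|ndm] := eqVneq (mdeg m) d; last first.
  rewrite (dhomog_nemf_coeff hh) // big1 // => a _; rewrite big1 // => b _.
  case: eqP => [mE|_]; last by rewrite mulr0.
  case/eqP: ndm; rewrite -mE mdegE3; have [-> -> ->] := mnE a b.
  have := ltn_ord a; have := ltn_ord b; lia.
have dm3 := dm; rewrite mdegE3 in dm3.
have a_lt : (m 1%R < d.+1)%N by lia.
have b_lt : (m (2%R : 'I_3) < d.+1 - Ordinal a_lt)%N by rewrite /=; lia.
rewrite (bigD1 (Ordinal a_lt)) //= (bigD1 (Ordinal b_lt)) //= -(mnP _ dm) eqxx mulr1.
rewrite !big1 ?addr0 // => [a na|b nb].
  rewrite big1 // => b _; case: eqP => [mE|_]; last by rewrite mulr0.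
  by case/eqP: na; apply: val_inj; rewrite /= -mE; have [_ ->] := mnE a b.
case: eqP => [mE|_]; last by rewrite mulr0.
by case/eqP: nb; apply: val_inj; have [_ _] := mnE (m 1) b; rewrite mE => /esym.
Qed.

Section Coordinates.
Variables (F : finFieldType) (K : closedFieldType) (iota : {rmorphism F -> K}).
Variables (T : 'M[F]_3).
Hypothesis unitT : T \in unitmx.
Implicit Types (v w : 'rV[K]_3) (p h : {mpoly F[3]}).
Local Notation TK := (map_mx iota T).

(** The first row of T will be P: (z, x, y), in this order, are the coordinates on
    the frame of the rows, and P is x = y = 0. *)
Definition coords v : 'rV[K]_3 := v *m map_mx iota (invmx T).
Definition of_coords (z x y : K) : 'rV[K]_3 := (\row_j [:: z; x; y]`_j) *m TK.

Definition coord_form (i : 'I_3) : {mpoly F[3]} := \sum_j invmx T j i *: 'X_j.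

Lemma coordsK v : coords v *m TK = v.
Proof. by rewrite /coords -mulmxA -map_mxM mulVmx // map_mx1 mulmx1. Qed.

Lemma coordsZ k v j : coords (k *: v) 0 j = k * coords v 0 j.
Proof. by rewrite /coords -scalemxAl mxE. Qed.

Lemma of_coordsK z x y : [/\ coords (of_coords z x y) 0 0 = z,
  coords (of_coords z x y) 0 1 = x & coords (of_coords z x y) 0 2 = y].
Proof. by rewrite /coords -mulmxA -map_mxM mulmxV // map_mx1 mulmx1 !mxE. Qed.

Lemma of_coordsE z x y : of_coords z x y = z *: map_mx iota (row 0 T) +
  x *: map_mx iota (row 1 T) + y *: map_mx iota (row 2 T).
Proof.
apply/rowP => j; rewrite !mxE !big_ord_recr big_ord0 /= !mxE add0r.
by congr (_ * iota (T _ _) + _ * iota (T _ _) + _ * iota (T _ _)); apply: val_inj.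
Qed.

Lemma coords_eq v : v = of_coords (coords v 0 0) (coords v 0 1) (coords v 0 2).
Proof.
rewrite -{1}[v]coordsK; congr (_ *m _); apply/rowP => -[[|[|[|//]]] lt3]; rewrite [RHS]mxE /=;
  by congr (coords v 0 _); apply: val_inj.
Qed.

Lemma value_at_coord v i : value_at iota v (coord_form i) = coords v 0 i.
Proof.
rewrite /coord_form rmorph_sum mxE; apply: eq_bigr => j _.
by rewrite -mul_mpolyC rmorphM /= value_atC value_atX !mxE mulrC.
Qed.

Lemma line_restriction_coord v w i :
  line_restriction iota v w (coord_form i) = (coords v 0 i)%:P + coords w 0 i *: 'X.
Proof.
apply/polyP => k; rewrite /coord_form rmorph_sum /= coef_sum coefD coefC coefZ coefX !mxE.
rewrite (eq_bigr (fun j => v 0 j * (map_mx iota (invmx T)) j i * (k == 0)%:R +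
   w 0 j * (map_mx iota (invmx T)) j i * (k == 1)%:R)); last first.
  move=> j _; rewrite -mul_mpolyC rmorphM /= line_restrictionC line_restrictionX.
  by rewrite coefCM coefD coefC coefZ coefX !mxE; case: (k) => [|[|n]] /=; ring.
by rewrite big_split -!mulr_suml; case: k => [|[|k]] /=; rewrite ?mulr1 ?mulr0.
Qed.

Lemma dhomog_coord i : coord_form i \is 1.-homog.
Proof. by apply: rpred_sum => j _; rewrite rpredZ // dhomogX /= mdeg1. Qed.

Lemma quartic_expansion h : h \is 4.-homog -> exists C : nat -> nat -> F,
  forall z x y, value_at iota (of_coords z x y) h =
    \sum_(a < 5) \sum_(b < 5 - a) iota (C a b) * (z ^+ (4 - a - b) * x ^+ a * y ^+ b).
Proof.
move=> hh; pose T_ := [tuple \sum_i T i j *: 'X_i | j < 3] : 3.-tuple {mpoly F[3]}.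
have hT j : tnth T_ j \is 1.-homog.
  by rewrite tnth_mktuple; apply: rpred_sum => i _; rewrite rpredZ // dhomogX /= mdeg1.
have : h \mPo T_ \is 4.-homog.
  rewrite comp_mpolyEX; rewrite big_seq; apply: rpred_sum => m mh; rewrite rpredZ //.
  rewrite comp_mpolyX -(dhomog_mf hh mh) /= mdegE.
  elim/big_ind2: _ => [|d1 p1 d2 p2|i _]; [exact: dhomog1 | exact: dhomogM |].
  by have := dhomogMn (m i) (hT i); rewrite mul1n.
case/ternary_formE => C hE; exists C => z x y.
transitivity (value_at iota (\row_j [:: z; x; y]`_j) (h \mPo T_)).
  move: h {hh hE}; apply: (mpoly_rmorph_ext
    (g := value_at iota (\row_j [:: z; x; y]`_j) \o comp_mpoly T_)) => [c|j] /=.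
    by rewrite comp_mpolyC !value_atC.
  rewrite value_atX comp_mpolyXU -tnth_nth tnth_mktuple rmorph_sum mxE.
  by apply: eq_bigr => i _; rewrite -mul_mpolyC rmorphM /= value_atC value_atX !mxE mulrC.
rewrite hE rmorph_sum; apply: eq_bigr => a _; rewrite rmorph_sum; apply: eq_bigr => b _.
by rewrite -mul_mpolyC !rmorphM !rmorphXn /= value_atC !value_atX !mxE.
Qed.

End Coordinates.

(** * Quartics singular at P and passing through R *)

Lemma rmorph_section_form (R S : comNzRingType) (f : {rmorphism R -> S})
    (L1 L2 N1 N2 m1 m2 : R) c x y z w :
  f (section_form L1 L2 N1 N2 m1 m2 c x y z w) =
  section_form (f L1) (f L2) (f N1) (f N2) (f m1) (f m2) (fun k => f (c k))
    (f x) (f y) (f z) (f w).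
Proof. by rewrite /section_form !(rmorphD, rmorphM, rmorphXn). Qed.

Lemma section_form_scale (R : comNzRingType) (L1 L2 N1 N2 m1 m2 : R) c t x y z :
  section_form L1 L2 N1 N2 m1 m2 c (t * x) (t * y) z 1 =
  t ^+ 2 * section_form L1 L2 N1 N2 m1 m2 c x y z t.
Proof. by rewrite /section_form; ring. Qed.

Lemma row_free_col_mxP (k : fieldType) (n : nat) (v w : 'rV[k]_n) :
  row_free (col_mx v w) <-> (forall a b, a *: v + b *: w = 0 -> a = 0 /\ b = 0).
Proof.
split=> [free a b ab0 | free].
  have /eqP : row_mx (a%:M : 'M_1) (b%:M : 'M_1) *m col_mx v w = 0.
    by rewrite mul_row_col !mul_scalar_mx.
  rewrite (mulmx_free_eq0 _ free) => /eqP ab.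
  have := congr1 lsubmx ab; have := congr1 rsubmx ab.
  rewrite row_mxKl row_mxKr => /matrixP/(_ 0 0) + /matrixP/(_ 0 0).
  by rewrite !mxE eqxx !mulr1n.
rewrite -kermx_eq0; apply/rowV0P => u /sub_kermxP.
rewrite -[u]hsubmxK mul_row_col [lsubmx u]mx11_scalar [rsubmx u]mx11_scalar.
rewrite !mul_scalar_mx => /free[-> ->].
by apply/rowP => j; rewrite mxE; case: split => i; rewrite !mxE mul0rn.
Qed.

Lemma row_free_neq0 (k : fieldType) (n : nat) (v w : 'rV[k]_n) : row_free (col_mx v w) -> v != 0.
Proof.
move/row_free_col_mxP => fr; apply/eqP => v0.
have [] := fr 1 0; first by rewrite v0 scaler0 scale0r addr0.
by move/eqP; rewrite oner_eq0.
Qed.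

Lemma mpoly_eq_of_value_at (F : finFieldType) (K : closedFieldType)
    (iota : {rmorphism F -> K}) (p h : {mpoly F[3]}) :
  (forall v, value_at iota v p = value_at iota v h) -> p = h.
Proof.
move=> ph; apply/eqP; rewrite -subr_eq0; apply/eqP/mpolyP => m.
apply: (fmorph_inj iota); rewrite -mcoeff_map_mpoly.
rewrite (mpoly_eq0_of_eval (p := map_mpoly iota (p - h))) ?mcoeff0 ?rmorph0 //.
by move=> v; rewrite -/(value_at iota v _) rmorphB /= ph subrr.
Qed.

Section Quartics.
Variables (F : finFieldType) (K : closedFieldType) (iota : {rmorphism F -> K}).
Variables (T : 'M[F]_3) (L1 L2 N1 N2 m1 m2 : F).
Hypothesis unitT : T \in unitmx.
Implicit Types (v w : 'rV[K]_3) (p h : {mpoly F[3]}) (c : 'rV[F]_8).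
Local Notation TK := (map_mx iota T).
Local Notation crd v := (coords iota T v).

Definition quartic c : {mpoly F[3]} :=
  section_form L1%:MP L2%:MP N1%:MP N2%:MP m1%:MP m2%:MP (fun k => (c 0 k)%:MP)
    (coord_form T 1) (coord_form T 2) (coord_form T 0) 1.

Definition form_value c (x y z w : K) : K :=
  section_form (iota L1) (iota L2) (iota N1) (iota N2) (iota m1) (iota m2)
    (fun k => iota (c 0 k)) x y z w.

Lemma value_at_quartic c v :
  value_at iota v (quartic c) = form_value c (crd v 0 1) (crd v 0 2) (crd v 0 0) 1.
Proof.
rewrite /quartic rmorph_section_form /= rmorph1 !value_at_coord /form_value.
by rewrite /section_form !value_atC.
Qed.

Lemma quartic_homog c : quartic c \is 4.-homog.
Proof.
have h1 := dhomog_coord T.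
have h2 i j : coord_form T i * coord_form T j \is 2.-homog := dhomogM (h1 i) (h1 j).
have hC d a (p : {mpoly F[3]}) : p \is d.-homog -> a%:MP * p \is d.-homog.
  by move=> hp; rewrite mul_mpolyC rpredZ.
have h2' i : coord_form T i ^+ 2 \is 2.-homog by rewrite expr2.
have hL a b i : (a%:MP * coord_form T 1 + b%:MP * coord_form T 2) * coord_form T i
    \is 2.-homog by apply: (dhomogM (d := 1)); rewrite ?rpredD ?hC.
rewrite /quartic /section_form !expr1n !mulr1.
by rewrite rpredD //; apply: (dhomogM (d := 2) (e := 2));
  do 3?[apply: rpredD]; rewrite ?hC ?hL ?h2 ?h2'.
Qed.

(** At a multiple v of P, the coordinates x and y of v + t w are t times those of w,
    and the form has degree 2 in (x, y): t^2 factors out. *)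
Lemma line_restriction_quartic c v w : crd v 0 1 = 0 -> crd v 0 2 = 0 ->
  exists2 p, line_restriction iota v w (quartic c) = 'X^2 * p &
    p`_0 = form_value c (crd w 0 1) (crd w 0 2) (crd v 0 0) 0.
Proof.
move=> v1 v2; pose p : {poly K} :=
  section_form (iota L1)%:P (iota L2)%:P (iota N1)%:P (iota N2)%:P (iota m1)%:P
   (iota m2)%:P (fun k => (iota (c 0 k))%:P) (crd w 0 1)%:P (crd w 0 2)%:P
   ((crd v 0 0)%:P + crd w 0 0 *: 'X) 'X.
exists p.
  rewrite /quartic rmorph_section_form /= rmorph1 !line_restriction_coord v1 v2.
  rewrite !add0r -!mul_polyC ![_ * 'X]mulrC section_form_scale.
  by rewrite /p /section_form !line_restrictionC -!mul_polyC ![_ * 'X]mulrC.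
rewrite -horner_coef0 -[LHS]/(horner_eval 0 p) rmorph_section_form /= /form_value.
by rewrite /section_form /horner_eval !hornerE.
Qed.

Lemma expansion_quartic c v w : crd v 0 1 = 0 -> crd v 0 2 = 0 ->
  expansion_at iota 2 v w (quartic c) =
  form_value c (crd w 0 1) (crd w 0 2) (crd v 0 0) 0.
Proof.
move=> v1 v2; have [p pE <-] := line_restriction_quartic c w v1 v2.
by rewrite -coef_line_restriction pE coefXnM.
Qed.

Lemma vanishes_quartic c v : crd v 0 1 = 0 -> crd v 0 2 = 0 ->
  vanishes_to_order iota 2 v (quartic c).
Proof.
move=> v1 v2; apply/vanishes_to_orderP => w i i2.
by have [p -> _] := line_restriction_quartic c w v1 v2; rewrite coefXnM i2.
Qed.

(* al is the direction of l, and (ze : al : 1) is a point of R. *)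
Variables (al ze : K).
Local Notation fixed2 x := (frob iota (frob iota x) = x).
Hypotheses (al2 : fixed2 al) (Mal : al ^+ 2 + iota m1 * al + iota m2 = 0).
Hypothesis indep_al : forall a b, iota a * al + iota b = 0 -> a = 0 /\ b = 0.
Hypothesis Qze :
  ze ^+ 2 + (iota L1 * al + iota L2) * ze + (iota N1 * al + iota N2) = 0.
Hypothesis indep_ze :
  forall a b, fixed2 a -> fixed2 b -> a * ze + b = 0 -> a = 0 /\ b = 0.

Lemma form_value_center c s : form_value c (s * al) s (s * ze) 1 = 0.
Proof.
rewrite /form_value /section_form.
transitivity (s ^+ 4 * (
  (iota (c 0 (inord 0)) * al ^+ 2 + iota (c 0 (inord 1)) * al + iota (c 0 (inord 2))) *
    (ze ^+ 2 + (iota L1 * al + iota L2) * ze + (iota N1 * al + iota N2)) +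
  (al ^+ 2 + iota m1 * al + iota m2) *
    ((iota (c 0 (inord 3)) * al + iota (c 0 (inord 4))) * ze +
     (iota (c 0 (inord 5)) * al ^+ 2 + iota (c 0 (inord 6)) * al + iota (c 0 (inord 7)))))).
  by ring.
by rewrite Qze Mal mulr0 mul0r addr0 mulr0.
Qed.

(** Vanishing to order 2 at P kills the coefficients C 0 0, C 1 0 and C 0 1.  At the
    point of R, subtracting A(al) times the equation of ze leaves E ze + D = 0 with
    E = (B - A L)(al) and D = (C - A N)(al) in F_(q^2), so both are zero.  Division
    by M then leaves remainders linear in al, which are zero as well: c4, c6, c7
    are coefficients of the quotients. *)
Lemma quartic_normal_form h s : s != 0 -> h \is 4.-homog ->
  (forall w i, row_free (col_mx (map_mx iota (row 0 T)) w) -> (i < 2)%N ->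
     expansion_at iota i (map_mx iota (row 0 T)) w h = 0) ->
  value_at iota (of_coords iota T (s * ze) (s * al) s) h = 0 ->
  exists c, h = quartic c.
Proof.
move=> nzs hh hP hR; have [C hE] := quartic_expansion iota T hh.
pose PK := map_mx iota (row 0 T).
have PtE t : PK + t *: map_mx iota (row 1 T) = of_coords iota T 1 t 0 /\
    PK + t *: map_mx iota (row 2 T) = of_coords iota T 1 0 t.
  by rewrite !of_coordsE !scale0r !scale1r !addr0.
have free (i : 'I_3) : i != 0 -> row_free (col_mx PK (map_mx iota (row i T))).
  rewrite -map_col_mx row_free_map => i0; apply/row_free_col_mxP => a b ab0.
  have : (a *: delta_mx 0 0 + b *: delta_mx 0 i) *m T = 0 :> 'rV_3.
    by rewrite mulmxDl -!scalemxAl -!rowE.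
  move/(congr1 (mulmx^~ (invmx T))); rewrite mulmxK // mul0mx => /rowP ab.
  have := ab 0; have := ab i; rewrite !mxE !eqxx /= ?[0 == i]eq_sym (negbTE i0).
  by rewrite !mulr0 !mulr1 add0r addr0.
have restr_eq w (cs : seq F) :
    (forall t, value_at iota (PK + t *: w) h = (Poly (map iota cs)).[t]) ->
    (1 < size cs)%N -> row_free (col_mx PK w) -> forall i, (i < 2)%N -> cs`_i = 0.
  move=> rE scs fw i i2;  apply: (fmorph_inj iota); rewrite rmorph0 -(hP w i fw i2).
  rewrite -coef_line_restriction; suff -> : line_restriction iota PK w h = Poly (map iota cs).
    by rewrite coef_Poly (nth_map 0) // (leq_trans i2).
  apply/eqP; rewrite -subr_eq0; apply/eqP/poly_eq0_of_roots => t.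
  by rewrite hornerD hornerN horner_line_restriction rE subrr.
have C1 := restr_eq _ [:: C 0 0; C 1 0; C 2 0; C 3 0; C 4 0].
have C2 := restr_eq _ [:: C 0 0; C 0 1; C 0 2; C 0 3; C 0 4].
have [C00 C10] : C 0 0 = 0 /\ C 1 0 = 0.
  have c1 : forall i, (i < 2)%N -> [:: C 0 0; C 1 0; C 2 0; C 3 0; C 4 0]`_i = 0.
    apply: (C1 (map_mx iota (row 1 T))) => // [t|]; last exact: free.
    rewrite (PtE t).1 hE horner_Poly !big_ord_recr !big_ord0 /=; ring.
  by split; [apply: (c1 0) | apply: (c1 1)].
have C01 : C 0 1 = 0.
  apply: (C2 (map_mx iota (row 2 T)) _ _ _ 1) => // [t|]; last exact: free.
  rewrite (PtE t).2 hE horner_Poly !big_ord_recr !big_ord0 /=; ring.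
have hV z x y : value_at iota (of_coords iota T z x y) h =
  (iota (C 2 0) * x ^+ 2 + iota (C 1 1) * (x * y) + iota (C 0 2) * y ^+ 2) * z ^+ 2 +
  (iota (C 3 0) * x ^+ 3 + iota (C 2 1) * (x ^+ 2 * y) + iota (C 1 2) * (x * y ^+ 2) +
   iota (C 0 3) * y ^+ 3) * z +
  (iota (C 4 0) * x ^+ 4 + iota (C 3 1) * (x ^+ 3 * y) + iota (C 2 2) * (x ^+ 2 * y ^+ 2) +
   iota (C 1 3) * (x * y ^+ 3) + iota (C 0 4) * y ^+ 4).
  by rewrite hE !big_ord_recr !big_ord0 /= C00 C10 C01 rmorph0; ring.
pose e3 := C 3 0 - C 2 0 * L1.
pose e2 := C 2 1 - C 2 0 * L2 - C 1 1 * L1.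
pose e1 := C 1 2 - C 1 1 * L2 - C 0 2 * L1.
pose e0 := C 0 3 - C 0 2 * L2.
pose f4 := C 4 0.
pose f3 := C 3 1 - C 2 0 * N1.
pose f2 := C 2 2 - C 2 0 * N2 - C 1 1 * N1.
pose f1 := C 1 3 - C 1 1 * N2 - C 0 2 * N1.
pose f0 := C 0 4 - C 0 2 * N2.
pose E := iota e3 * al ^+ 3 + iota e2 * al ^+ 2 + iota e1 * al + iota e0.
pose D := iota f4 * al ^+ 4 + iota f3 * al ^+ 3 + iota f2 * al ^+ 2 + iota f1 * al + iota f0.
have [E0 D0] : E = 0 /\ D = 0.
  have fx (cs : seq F) : fixed2 (Poly (map iota cs)).[al].
    elim: cs => [|c cs IH] /=; first by rewrite horner0 !rmorph0.
    by rewrite horner_cons !rmorphD !rmorphM /= !frob_base IH al2.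
  apply: indep_ze.
  - by rewrite [E](_ : _ = (Poly (map iota [:: e0; e1; e2; e3])).[al]) ?fx // horner_Poly /E /=; ring.
  - by rewrite [D](_ : _ = (Poly (map iota [:: f0; f1; f2; f3; f4])).[al]) ?fx // horner_Poly /D /=; ring.
  apply: (mulfI (expf_neq0 4 nzs)); rewrite mulr0 -hR hV.
  transitivity (s ^+ 4 * (E * ze + D + (iota (C 2 0) * al ^+ 2 + iota (C 1 1) * al + iota (C 0 2)) *
    (ze ^+ 2 + (iota L1 * al + iota L2) * ze + (iota N1 * al + iota N2)))).
    by rewrite Qze mulr0 addr0.
  by rewrite /E /D /e3 /e2 /e1 /e0 /f4 /f3 /f2 /f1 /f0; ring.
pose c4 := e2 - m1 * e3.
have [E1 E2] : e1 - m2 * e3 - m1 * c4 = 0 /\ e0 - m2 * c4 = 0.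
  apply: indep_al; rewrite -[RHS]E0.
  transitivity (E - (al ^+ 2 + iota m1 * al + iota m2) * (iota e3 * al + iota c4)).
    by rewrite /E /c4; ring.
  by rewrite Mal mul0r subr0.
pose c6 := f3 - m1 * f4.
pose c7 := f2 - m1 * c6 - m2 * f4.
have [D1 D2] : f1 - m1 * c7 - m2 * c6 = 0 /\ f0 - m2 * c7 = 0.
  apply: indep_al; rewrite -[RHS]D0.
  transitivity (D - (al ^+ 2 + iota m1 * al + iota m2) *
      (iota f4 * al ^+ 2 + iota c6 * al + iota c7)).
    by rewrite /D /c7 /c6; ring.
  by rewrite Mal mul0r subr0.
pose cs := [:: C 2 0; C 1 1; C 0 2; e3; c4; f4; c6; c7].
exists (\row_k cs`_k); apply: (mpoly_eq_of_value_at (iota := iota)) => v.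
rewrite value_at_quartic {1}(coords_eq iota unitT v) hV /form_value /section_form.
have csE k : (k < 8)%N -> (\row_(k < 8) cs`_k) 0 (inord k) = cs`_k.
  by move=> k8; rewrite mxE inordK.
rewrite !csE //=.
have -> : C 0 3 = C 0 3 - (e0 - m2 * c4) by rewrite E2 subr0.
have -> : C 1 2 = C 1 2 - (e1 - m2 * e3 - m1 * c4) by rewrite E1 subr0.
have -> : C 0 4 = C 0 4 - (f0 - m2 * c7) by rewrite D2 subr0.
have -> : C 1 3 = C 1 3 - (f1 - m1 * c7 - m2 * c6) by rewrite D1 subr0.
by rewrite /c7 /c6 /c4 /e3 /e2 /e1 /e0 /f4 /f3 /f2 /f1 /f0; ring.
Qed.

End Quartics.

(** * The direction of l and the position of R *)

Section Center.
Variables (F : finFieldType) (K : closedFieldType) (iota : {rmorphism F -> K}).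
Local Notation phi := (frob iota).
Local Notation fixed2 x := (phi (phi x) = x).

(** F_(q^2) = F al + F: the coefficient of al is (x - x^q) / (al - al^q), which is
    fixed by the Frobenius. *)
Lemma fixed2_span al x : fixed2 al -> phi al != al -> fixed2 x ->
  exists a b, x = iota a * al + iota b.
Proof.
move=> al2 nal x2; have nz : al - phi al != 0 by rewrite subr_eq0 eq_sym.
have [|a aE] := @frob_fixedP _ _ iota ((x - phi x) / (al - phi al)).
  rewrite fmorph_div !rmorphB /= x2 al2 -[phi x - x]opprB -[phi al - al]opprB.
  by rewrite invrN mulrNN.
have xE : x - phi x = iota a * (al - phi al) by rewrite -aE divfK.
have [|b bE] := @frob_fixedP _ _ iota (x - iota a * al).
  rewrite rmorphB rmorphM /= frob_base; apply/eqP; rewrite -subr_eq0; apply/eqP.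
  transitivity (iota a * (al - phi al) - (x - phi x)); first by ring.
  by rewrite xE subrr.
by exists a, b; rewrite -bE addrC subrK.
Qed.

Lemma frobenius_of_coords (T : 'M[F]_3) z x y :
  frobenius F (of_coords iota T z x y) = of_coords iota T (phi z) (phi x) (phi y).
Proof.
rewrite (frobeniusE iota) /of_coords map_mxM; congr (_ *m _).
  by apply/rowP => -[[|[|[|//]]] lt3]; rewrite !mxE.
by apply/matrixP => i j; rewrite !mxE /= frob_base.
Qed.

Lemma of_coordsZ (T : 'M[F]_3) s z x y :
  of_coords iota T (s * z) (s * x) (s * y) = s *: of_coords iota T z x y.
Proof. by rewrite !of_coordsE !scalerDr !scalerA. Qed.

Variables (T : 'M[F]_3) (l r : 'rV[K]_3).
Hypothesis unitT : T \in unitmx.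
Hypothesis hr : closed_point F 4 r.

(** As l passes through P, it is given by two coefficients a and b on x and y; their
    ratio is in F_(q^2) and not in F, by the hypothesis on l.  The conditions on ze
    express that r has degree exactly 4. *)
Lemma center_parameters : quadratic_line F l ->
  on_line (map_mx iota (row 0 T)) l -> on_line r l ->
  exists al ze s, [/\ s != 0, r = of_coords iota T (s * ze) (s * al) s,
    fixed2 al /\ phi al != al & phi (phi (phi (phi ze))) = ze /\ phi (phi ze) != ze].
Proof.
case=> nzl l2 nl Pl rl.
have [m mE] : exists m, m = map_mx iota T *m l^T by eexists.
pose a := m 1 0; pose b := m 2 0.
have m0 : m 0 0 = 0.
  by have /matrixP/(_ 0 0) := Pl; rewrite mE map_row -row_mul !mxE.
have unitTK : map_mx iota T \in unitmx by rewrite map_unitmx.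
have TKE : map_mx phi (map_mx iota T) = map_mx iota T.
  by apply/matrixP => i j; rewrite !mxE /= frob_base.
have mphi (l' : 'rV[K]_3) : map_mx iota T *m (frobenius F l')^T = map_mx phi (map_mx iota T *m l'^T).
  by rewrite (frobeniusE iota) map_trmx map_mxM /= TKE.
have m_inj (l' l'' : 'rV[K]_3) c :
    map_mx iota T *m l'^T = c *: (map_mx iota T *m l''^T) -> l' = c *: l''.
  move=> e; apply: trmx_inj; apply: (can_inj (mulKmx unitTK)).
  by rewrite linearZ /= -scalemxAr.
have m_eq (m' m'' : 'cV[K]_3) c : m' 0 0 = 0 -> m'' 0 0 = 0 -> m' 1 0 = c * m'' 1 0 ->
    m' 2 0 = c * m'' 2 0 -> m' = c *: m''.
  move=> m'0 m''0 e1 e2; apply/matrixP => i j; rewrite ord1 mxE.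
  case: i => -[|[|[|//]]] lt3.
  - by rewrite (_ : Ordinal lt3 = 0) ?m'0 ?m''0 ?mulr0 //; apply: val_inj.
  - by rewrite (_ : Ordinal lt3 = 1) //; apply: val_inj.
  - by rewrite (_ : Ordinal lt3 = 2) //; apply: val_inj.
have not_scaled (c : K) : phi a = c * a -> phi b = c * b -> c != 0 -> False.
  move=> ac bc nzc; case/negP: nl; rewrite (m_inj (frobenius F l) l c) ?scale_row_eq //.
  rewrite mphi -mE; apply: m_eq => //; rewrite mxE ?m0 ?rmorph0 //.
have nz_a : a != 0.
  apply/eqP => a0; have nzb : b != 0.
    apply: contra nzl => /eqP b0; rewrite (m_inj l 0 0) ?scale0r //.
    by rewrite -mE -[RHS](scale0r m); apply: m_eq; rewrite ?mul0r.
  by apply: (not_scaled (phi b / b)); rewrite ?a0 ?rmorph0 ?mulr0 ?divfK // mulf_neq0 ?invr_eq0 ?fmorph_eq0.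
pose be := - b / a.
have bE : b = - be * a by rewrite /be mulNr divfK // opprK.
have be1 : phi be != be.
  apply/eqP => e; apply: (not_scaled (phi a / a)); rewrite ?divfK //.
    by rewrite {1}bE rmorphM rmorphN /= e bE; field.
  by rewrite mulf_neq0 ?invr_eq0 ?fmorph_eq0.
have be2 : fixed2 be.
  have nz2 : frobenius F (frobenius F l) != 0 by rewrite !(frobeniusE iota) !map_mx_eq0.
  have [c nzc e2] := row_eq_scale nz2 l2.
  have m2 : map_mx phi (map_mx phi m) = c *: m.
    by rewrite mE -!mphi e2 linearZ /= -scalemxAr.
  have ea : phi (phi a) = c * a by have /matrixP/(_ 1 0) := m2; rewrite !mxE.
  have eb : phi (phi b) = c * b by have /matrixP/(_ 2 0) := m2; rewrite !mxE.
  by rewrite /be !fmorph_div !rmorphN /= ea eb; field; rewrite nzc nz_a.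
set r0 := coords iota T r 0 0; set r1 := coords iota T r 0 1; set r2 := coords iota T r 0 2.
have rE : r = of_coords iota T r0 r1 r2 by apply: coords_eq.
have rab : r1 * a + r2 * b = 0.
  move/matrixP/(_ 0 0): rl; rewrite {1}rE /of_coords -mulmxA -mE !mxE.
  rewrite !big_ord_recr big_ord0 /= !mxE /= add0r => <-.
  have -> : widen_ord (leqnSn 2) (widen_ord (leqnSn 1) ord_max) = 0 by apply: val_inj.
  have -> : widen_ord (leqnSn 2) ord_max = 1 by apply: val_inj.
  have -> : (ord_max : 'I_3) = 2 by apply: val_inj.
  by rewrite m0 mulr0 add0r.
case: hr => nzr r4 ri.
have nz4 : iter 4 (@frobenius F K) r != 0 by rewrite iter_frobenius_neq0.
have [c nzc r4E] := row_eq_scale nz4 r4.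
have nr2 : r2 != 0.
  apply/eqP => r20; case/negP: (ri 1 isT) => /=.
  have r10 : r1 = 0.
    by move/eqP: rab; rewrite r20 mul0r addr0 mulf_eq0 (negbTE nz_a) orbF => /eqP.
  have rE' : r = r0 *: map_mx iota (row 0 T).
    by rewrite rE of_coordsE r10 r20 !scale0r !addr0.
  have nr0 : r0 != 0 by apply: contra nzr => /eqP e; rewrite rE' e scale0r.
  rewrite (_ : frobenius F r = (phi r0 / r0) *: r).
    by rewrite scale_row_eq // mulf_neq0 ?invr_eq0 ?fmorph_eq0.
  rewrite {2}rE' scalerA divfK // rE' (frobeniusE iota).
  by rewrite map_mxZ -(frobeniusE iota) frobenius_base.
have alE : r1 / r2 = be.
  rewrite /be; apply: (mulIf nr2); apply: (mulIf nz_a); rewrite divfK //.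
  apply/eqP; rewrite -subr_eq0; apply/eqP; rewrite -[RHS]rab; field.
  by rewrite nz_a.
have [ze zeE] : exists ze, ze = r0 / r2 by eexists.
have r'E : r = of_coords iota T (r2 * ze) (r2 * be) r2.
  by rewrite zeE -alE ![r2 * (_ / _)]mulrC !divfK.
exists be, ze, r2; split=> //; split.
  have := r4E; rewrite {1}r'E r'E /= !frobenius_of_coords -of_coordsZ.
  move/(congr1 (coords iota T)).
  move=> e; have [e0 _ e2'] := of_coordsK iota unitT (phi (phi (phi (phi (r2 * ze))))) (phi (phi (phi (phi (r2 * be))))) (phi (phi (phi (phi r2)))).
  move: e0 e2'; rewrite e; have [-> _ ->] := of_coordsK iota unitT (c * (r2 * ze)) (c * (r2 * be)) (c * r2).
  move=> e0 e2'; rewrite !rmorphM /= -e2' in e0.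
  have nzcr : c * r2 != 0 by rewrite mulf_neq0.
  by apply: (mulfI nzcr); rewrite -e0 mulrA.
apply/eqP => ze2; case/negP: (ri 2 isT) => /=.
rewrite (_ : frobenius F _ = (phi (phi r2) / r2) *: r).
  by rewrite scale_row_eq // mulf_neq0 ?invr_eq0 ?fmorph_eq0.
have ->: phi (phi r2) / r2 *: r = of_coords iota T (phi (phi r2) * ze) (phi (phi r2) * be) (phi (phi r2)).
  by rewrite {1}r'E -of_coordsZ !mulrA divfK.
rewrite r'E !frobenius_of_coords (_ : phi (phi (r2 * be)) = phi (phi r2) * be).
  by rewrite (_ : phi (phi (r2 * ze)) = phi (phi r2) * ze) // rmorphM rmorphM /= ze2.
by rewrite rmorphM rmorphM /= be2.
Qed.

End Center.

Section CenterData.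
Variables (F : finFieldType) (K : closedFieldType) (iota : {rmorphism F -> K}).
Local Notation phi := (frob iota).
Local Notation fixed2 x := (phi (phi x) = x).
Variables al ze : K.
Hypotheses (al2 : fixed2 al) (nal : phi al != al).
Hypotheses (ze4 : phi (phi (phi (phi ze))) = ze) (nze : phi (phi ze) != ze).

Lemma indep_al a b : iota a * al + iota b = 0 -> a = 0 /\ b = 0.
Proof.
move=> e; have [a0|nza] := eqVneq a 0.
  by move: e; rewrite a0 rmorph0 mul0r add0r => /eqP; rewrite fmorph_eq0 => /eqP.
case/eqP: nal; have -> : al = iota (- b / a).
  rewrite fmorph_div rmorphN; apply: (canRL (mulfK _)); first by rewrite fmorph_eq0.
  by rewrite mulrC; apply/eqP; rewrite -addr_eq0 e.
by rewrite frob_base.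
Qed.

Lemma indep_ze a b : fixed2 a -> fixed2 b -> a * ze + b = 0 -> a = 0 /\ b = 0.
Proof.
move=> a2 b2 e; have [a0|nza] := eqVneq a 0.
  by move: e; rewrite a0 mul0r add0r.
case/eqP: nze; have -> : ze = - b / a.
  by apply: (canRL (mulfK _)) => //; rewrite mulrC; apply/eqP; rewrite -addr_eq0 e.
by rewrite !fmorph_div !rmorphN /= a2 b2.
Qed.

Lemma center_equations : exists L1 L2 N1 N2 m1 m2,
  al ^+ 2 + iota m1 * al + iota m2 = 0 /\
  ze ^+ 2 + (iota L1 * al + iota L2) * ze + (iota N1 * al + iota N2) = 0.
Proof.
have sq2 : fixed2 (al * al) by rewrite !rmorphM /= al2.
have sum2 : fixed2 (ze + phi (phi ze)) by rewrite !rmorphD /= ze4 addrC.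
have prod2 : fixed2 (ze * phi (phi ze)) by rewrite !rmorphM /= ze4 mulrC.
have [a [b e]] := fixed2_span al2 nal sq2.
have [c [d e']] := fixed2_span al2 nal sum2.
have [f [g e'']] := fixed2_span al2 nal prod2.
exists (- c), (- d), f, g, (- a), (- b); rewrite !rmorphN; split.
  transitivity (al * al - (iota a * al + iota b)); first by ring.
  by rewrite e subrr.
rewrite -e'' (_ : - iota c * al - iota d = - (ze + phi (phi ze))); first by ring.
by rewrite e'; ring.
Qed.

Variables L1 L2 N1 N2 m1 m2 : F.
Hypothesis Mal : al ^+ 2 + iota m1 * al + iota m2 = 0.
Hypothesis Qze :
  ze ^+ 2 + (iota L1 * al + iota L2) * ze + (iota N1 * al + iota N2) = 0.

(** A rational zero (a : 1) of M would be al or its conjugate. *)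
Lemma norm_form_neq0 d : quad 1 m1 m2 (px d) (py d) != 0.
Proof.
case: d => [a|] /=; last by rewrite /quad expr1n !mulr0 expr0n /= mulr0 !addr0 mulr1 oner_eq0.
apply/eqP => /(congr1 iota); rewrite rmorph0 => e.
have : (al - iota a) * (al + iota a + iota m1) = 0.
  transitivity (al ^+ 2 + iota m1 * al + iota m2 - iota (quad 1 m1 m2 a 1)).
    by rewrite /quad; ring.
  by rewrite Mal e subrr.
move/eqP; rewrite mulf_eq0 => /orP[] /eqP e0.
  have [] := @indep_al 1 (- a); first by rewrite rmorph1 mul1r rmorphN.
  by move/eqP; rewrite oner_eq0.
have [] := @indep_al 1 (a + m1); first by rewrite rmorph1 mul1r rmorphD addrA.
by move/eqP; rewrite oner_eq0.
Qed.

(** The line through two such points lies on the conic; extended to K it meets l, of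
    direction al, in a point whose coordinate Z / de is in F_(q^2).  There M vanishes,
    so this coordinate would be ze or its conjugate. *)
Lemma conic_no_line t x y z x' y' z' : x * y' - y * x' != 0 ->
  conic L1 L2 t (N1 + t * m1) (N2 + t * m2) x y z = 0 ->
  conic L1 L2 t (N1 + t * m1) (N2 + t * m2) x' y' z' = 0 ->
  polar L1 L2 t (N1 + t * m1) (N2 + t * m2) x y z x' y' z' = 0 -> False.
Proof.
set de := x * y' - y * x' => nzd /(congr1 iota) e1 /(congr1 iota) e2 /(congr1 iota) e3.
rewrite !rmorph0 in e1 e2 e3.
(* A and B combine the two points into one of direction de (al, 1). *)
pose A := al * iota y' - iota x'; pose B := iota x - al * iota y.
pose Z := A * iota z + B * iota z'.
have A2 : fixed2 A by rewrite /A !rmorphB !rmorphM /= !frob_base al2.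
have B2 : fixed2 B by rewrite /B !rmorphB !rmorphM /= !frob_base al2.
have Z2 : fixed2 Z by rewrite /Z !rmorphD !rmorphM /= !frob_base A2 B2.
have : (iota de * ze - Z) * (iota de * ze + (Z + iota de * (iota L1 * al + iota L2))) = 0.
  transitivity (iota de ^+ 2 * (ze ^+ 2 + (iota L1 * al + iota L2) * ze + (iota N1 * al + iota N2)) -
    (A ^+ 2 * iota (conic L1 L2 t (N1 + t * m1) (N2 + t * m2) x y z) +
     B ^+ 2 * iota (conic L1 L2 t (N1 + t * m1) (N2 + t * m2) x' y' z') +
     A * B * iota (polar L1 L2 t (N1 + t * m1) (N2 + t * m2) x y z x' y' z')) +
    iota t * iota de ^+ 2 * (al ^+ 2 + iota m1 * al + iota m2)).
    by rewrite /Z /A /B /de /conic /polar /quad; ring.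
  by rewrite Mal Qze e1 e2 e3 !mulr0 !addr0 subrr.
clearbody Z; have nzid : iota de != 0 by rewrite fmorph_eq0.
have de2 : fixed2 (iota de) by rewrite !frob_base.
move/eqP; rewrite mulf_eq0 => /orP[] /eqP e0.
  have [|/eqP] := indep_ze de2 _ e0; first by rewrite !rmorphN /= Z2.
  by rewrite (negbTE nzid).
have [|/eqP] := indep_ze de2 _ e0; last by rewrite (negbTE nzid).
by rewrite !(rmorphD, rmorphM) /= !frob_base al2 Z2.
Qed.

(** Otherwise ze^2 would be in F_(q^2), and so would ze, as square roots are unique
    in characteristic 2. *)
Lemma separable_fibres : 2%:R = 0 :> F -> (L1 != 0) || (L2 != 0).
Proof.
move=> two0; apply: contraR nze; rewrite negb_or !negbK => /andP[/eqP L10 /eqP L20].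
have zeE : ze ^+ 2 = - (iota N1 * al + iota N2).
  by apply/eqP; rewrite -addr_eq0 -Qze L10 L20 !rmorph0 mul0r addr0 mul0r addr0.
have zz : phi (phi ze) ^+ 2 = ze ^+ 2.
  rewrite -!rmorphXn /= zeE !rmorphN !rmorphD !rmorphM /= !frob_base al2 //.
have twoK : 2%:R = 0 :> K by rewrite -(rmorph_nat iota) two0 rmorph0.
rewrite -subr_eq0 -sqrf_eq0; apply/eqP.
transitivity (phi (phi ze) ^+ 2 - ze ^+ 2 + 2%:R * (ze ^+ 2 - phi (phi ze) * ze)).
  by ring.
by rewrite zz twoK subrr mul0r addr0.
Qed.

End CenterData.

(** * The grid of rational points *)

Lemma same_point_sym (k : fieldType) (y z : blowup_point k) :
  same_point y z = same_point z y.
Proof.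
case: y z => [v|v w] [v'|v' w']; rewrite /same_point //; first by rewrite andbC.
by congr (_ && _); rewrite andbC.
Qed.

Lemma same_point_trans (k : fieldType) (x y z : blowup_point k) :
  same_point x y -> same_point y z -> same_point x z.
Proof.
have tr m1 m2 m3 n (A : 'M[k]_(m1, n)) (B : 'M_(m2, n)) (C : 'M_(m3, n)) :
    (A == B -> B == C -> A == C)%MS.
  by move=> /andP[a b] /andP[c d]; rewrite (submx_trans a c) (submx_trans d b).
case: x y z => [v|v w] [v'|v' w'] [v''|v'' w'']; rewrite /same_point //; first exact: tr.
case/andP=> a b /andP[c d]; apply/andP; split; [exact: tr a c | exact: tr b d].
Qed.

Lemma col_mx_eqP (k : fieldType) (n : nat) (v w v' w' : 'rV[k]_n) :
  (col_mx v w == col_mx v' w')%MS -> exists a b, w = a *: v' + b *: w'.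
Proof.
case/andP; rewrite col_mx_sub => /andP[_ sub] _.
have /sub_addsmxP[[A B] /= ->] : (w <= v' + w')%MS by rewrite addsmxE.
by exists (A 0 0), (B 0 0); rewrite [A]mx11_scalar [B]mx11_scalar !mul_scalar_mx !mxE !mulr1n.
Qed.

Lemma col_mx_eq (k : fieldType) (n : nat) (v w v' w' : 'rV[k]_n) x a b :
  x != 0 -> b != 0 -> v = x *: v' -> w = a *: v' + b *: w' ->
  (col_mx v w == col_mx v' w')%MS.
Proof.
move=> nx nb -> ->.
have sl (A B : 'rV[k]_n) : (A <= col_mx A B)%MS by rewrite -addsmxE addsmxSl.
have sr (A B : 'rV[k]_n) : (B <= col_mx A B)%MS by rewrite -addsmxE addsmxSr.
have sv : (v' <= col_mx (x *: v') (a *: v' + b *: w'))%MS.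
  by apply: submx_trans (sl _ _); rewrite (eqmx_scale _ nx).
rewrite !col_mx_sub addmx_sub ?scalemx_sub // sv /=.
have wE : b *: w' = - (a *: v') + (a *: v' + b *: w') by rewrite addKr.
rewrite -(eqmx_scale w' nb) {1}wE addmx_sub //.
by rewrite -scaleNr scalemx_sub.
Qed.

Section RationalPoints.
Variables (F : finFieldType) (K : closedFieldType) (iota : {rmorphism F -> K}).
Variables (T : 'M[F]_3) (r : 'rV[K]_3).
Hypothesis unitT : T \in unitmx.
Hypothesis hr : closed_point F 4 r.
Local Notation P := (row 0 T).

Definition tangent (d : option F) : 'rV[F]_3 := px d *: row 1 T + py d *: row 2 T.

Definition grid_point (t : option F * option F) : blowup_point F :=
  if t.2 is Some z then Off (z *: P + tangent t.1) else Exc P (tangent t.1).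

Lemma frame_free (a b c : F) :
  a *: row 0 T + b *: row 1 T + c *: row 2 T = 0 -> [/\ a = 0, b = 0 & c = 0].
Proof.
rewrite !rowE !scalemxAl -!mulmxDl => /(congr1 (mulmx^~ (invmx T))).
rewrite mulmxK // mul0mx => /rowP e.
have := e 0; have := e 1; have := e 2; rewrite !mxE /=.
by rewrite !mulr0 !mulr1 !addr0 !add0r => -> -> ->.
Qed.

Lemma frame_decomposition (v : 'rV[F]_3) :
  exists a b c, v = a *: row 0 T + b *: row 1 T + c *: row 2 T.
Proof.
have [e ->] : exists e, v = e *m T by exists (v *m invmx T); rewrite mulmxKV.
exists (e 0 0), (e 0 1), (e 0 2).
apply/rowP => j; rewrite !mxE !big_ord_recr big_ord0 /= add0r.
by congr (e _ _ * T _ _ + e _ _ * T _ _ + e _ _ * T _ _); apply: val_inj.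
Qed.

Lemma direction_of_pair (a b : F) : (a != 0) || (b != 0) ->
  exists d k, [/\ k != 0, a = k * px d & b = k * py d].
Proof.
have [-> /= |nb _] := eqVneq b 0.
  by rewrite orbF => na; exists None, a; rewrite /= mulr1 mulr0.
by exists (Some (a / b)), b; rewrite /= mulr1 mulrC divfK.
Qed.

Lemma pxy_both_eq0 (d : option F) : (px d = 0) -> (py d = 0) -> False.
Proof. by case: d => [a|] /= e e'; move/eqP: e; move/eqP: e'; rewrite ?oner_eq0. Qed.

Lemma above_P_base (v : 'rV[F]_3) : above_P iota P (map_mx iota v) = (v == P)%MS.
Proof. by rewrite /above_P !map_submx. Qed.

Lemma rational_pointE (y : blowup_point F) : rational_point iota P r y <->
  match y with
  | Off v => v != 0 /\ ~~ (v == P)%MS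
  | Exc v w => (v == P)%MS /\ row_free (col_mx v w)
  end.
Proof.
rewrite /rational_point; case: y => [v|v w] /=; rewrite ?above_P_base.
  rewrite (negbTE (rational_not_above_R iota v hr)).
  by split=> [[]|[nv nP]]; rewrite ?map_mx_eq0 //; split; rewrite ?map_mx_eq0.
rewrite (negbTE (rational_not_above_R iota v hr)) orbF -map_col_mx row_free_map.
by [].
Qed.

Lemma P_neq0 : P != 0.
Proof.
apply/eqP => P0; have [] := @frame_free 1 0 0; first by rewrite P0 !scaler0 !scale0r !addr0.
by move/eqP; rewrite oner_eq0.
Qed.

Lemma grid_point_rational t : rational_point iota P r (grid_point t).
Proof.
case: t => d [z|]; apply/rational_pointE => /=; split => //.
- apply/eqP => e; have [|_] := @frame_free z (px d) (py d); last exact: pxy_both_eq0.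
  by rewrite -addrA.
- apply/negP => /andP[/sub_rVP[a e] _].
  have [|_] := @frame_free (z - a) (px d) (py d); last exact: pxy_both_eq0.
  by rewrite scalerBl -e -[LHS]addrA -/(tangent d) opprD (addrA (z *: P)) subrr add0r addNr.
- by rewrite submx_refl.
apply/row_free_col_mxP => a b e.
have [|-> bx by0] := @frame_free a (b * px d) (b * py d).
  by rewrite -!scalerA -addrA -scalerDr.
split=> //; apply/eqP; apply: contraT => nb.
move/eqP: bx; move/eqP: by0; rewrite !mulf_eq0 (negbTE nb) /= => /eqP y0 /eqP x0.
by case: (pxy_both_eq0 x0 y0).
Qed.

Lemma grid_point_surj y : rational_point iota P r y -> exists t, same_point y (grid_point t).
Proof.
move/rational_pointE; case: y => [v [nv nP]|v w [vP free]].
  have [a [b [c vE]]] := frame_decomposition v.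
  have nbc : (b != 0) || (c != 0).
    apply: contraR nP; rewrite negb_or !negbK => /andP[/eqP b0 /eqP c0].
    have vE' : v = a *: P by rewrite vE b0 c0 !scale0r !addr0.
    have na : a != 0 by apply: contra nv => /eqP a0; rewrite vE' a0 scale0r.
    by rewrite vE' scale_row_eq.
  have [d [k [nk bE cE]]] := direction_of_pair nbc.
  exists (d, Some (a / k)) => /=.
  have -> : v = k *: (a / k *: P + tangent d).
    by rewrite vE bE cE /tangent !scalerDr !scalerA addrA [k * (a / k)]mulrC divfK.
  exact: scale_row_eq.
have [x nx vE] := row_eq_scale (row_free_neq0 free) vP.
have [a [b [c wE]]] := frame_decomposition w.
have nbc : (b != 0) || (c != 0).
  apply: contraT; rewrite negb_or !negbK => /andP[/eqP b0 /eqP c0].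
  have /row_free_col_mxP/(_ a (- x))[] := free.
    by rewrite vE wE b0 c0 !scale0r !addr0 !scalerA mulNr scaleNr mulrC subrr.
  by move=> _ /eqP; rewrite oppr_eq0 (negbTE nx).
have [d [k [nk bE cE]]] := direction_of_pair nbc.
exists (d, None) => /=; rewrite vP /=.
have wE' : w = a *: P + k *: tangent d by rewrite wE bE cE /tangent scalerDr !scalerA addrA.
exact: col_mx_eq vE wE'.
Qed.

Lemma frame_inj (a b c a' b' c' : F) :
  a *: row 0 T + b *: row 1 T + c *: row 2 T =
  a' *: row 0 T + b' *: row 1 T + c' *: row 2 T -> [/\ a = a', b = b' & c = c'].
Proof.
move/eqP; rewrite -subr_eq0 => /eqP e.
have [|/eqP + /eqP + /eqP] := @frame_free (a - a') (b - b') (c - c').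
  by rewrite -[RHS]e !scalerBl !opprD [RHS]addrACA; congr (_ + _); rewrite [RHS]addrACA.
by rewrite !subr_eq0 => /eqP-> /eqP-> /eqP->.
Qed.

Lemma direction_inj d d' (k : F) : px d = k * px d' -> py d = k * py d' -> d = d'.
Proof.
move=> e e'; apply/eqP; rewrite -cross_eq0 e e' subr_eq0 -!mulrA; apply/eqP.
by congr (_ * _); rewrite mulrC.
Qed.

Lemma grid_point_inj t t' : same_point (grid_point t) (grid_point t') -> t = t'.
Proof.
case: t t' => d [z|] [d' [z'|]] //=; last first.
  case/andP=> _ /col_mx_eqP[a [b /eqP]].
  rewrite /tangent scalerDr !scalerA addrA -subr_eq0 => /eqP e.
  have [_ e1 e2] : [/\ 0 = a, px d = b * px d' & py d = b * py d'].
    by apply: frame_inj; rewrite scale0r add0r; apply/eqP; rewrite -subr_eq0 e.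
  by rewrite (direction_inj e1 e2).
have nz : z *: P + tangent d != 0.
  apply/eqP => e; have [|_] := @frame_free z (px d) (py d); last exact: pxy_both_eq0.
  by rewrite -addrA.
case/(row_eq_scale nz) => k nk; rewrite /tangent !scalerDr !scalerA !addrA.
case/frame_inj => e0 e1 e2; have dd := direction_inj e1 e2; rewrite -dd in e1 e2 *.
suff k1 : k = 1 by rewrite e0 k1 mul1r.
by case: (d) e1 e2 => [y|] /=; rewrite mulr1.
Qed.

End RationalPoints.

(** * The code *)

Section Code.
Variables (F : finFieldType) (K : closedFieldType) (iota : {rmorphism F -> K}).
Variables (T : 'M[F]_3) (r : 'rV[K]_3) (L1 L2 N1 N2 m1 m2 : F) (al ze s : K).
Hypothesis unitT : T \in unitmx.
Hypothesis hr : closed_point F 4 r.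
Local Notation P := (row 0 T).
Local Notation q := #|F|.
Local Notation phi := (frob iota).
Local Notation gvalue := (value L1 L2 N1 N2 m1 m2).
Local Notation zeros := (zeros L1 L2 N1 N2 m1 m2).
Local Notation quartic := (quartic T L1 L2 N1 N2 m1 m2).
Local Notation form_value := (form_value iota L1 L2 N1 N2 m1 m2).

Hypotheses (nzs : s != 0) (rE : r = of_coords iota T (s * ze) (s * al) s).
Hypotheses (al2 : phi (phi al) = al) (nal : phi al != al).
Hypothesis nze : phi (phi ze) != ze.
Hypothesis Mal : al ^+ 2 + iota m1 * al + iota m2 = 0.
Hypothesis Qze :
  ze ^+ 2 + (iota L1 * al + iota L2) * ze + (iota N1 * al + iota N2) = 0.

Definition local_value (y : blowup_point K) (h : {mpoly F[3]}) : K :=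
  match y with
  | Off v => value_at iota v h
  | Exc v w => expansion_at iota 2 v w h
  end.

Lemma form_value_iota c x y z w : form_value c (iota x) (iota y) (iota z) (iota w) =
  iota (section_form L1 L2 N1 N2 m1 m2 (c 0) x y z w).
Proof. by rewrite rmorph_section_form. Qed.

Lemma form_value_homog c k x y z :
  form_value c (k * x) (k * y) (k * z) 1 = k ^+ 4 * form_value c x y z 1.
Proof. by rewrite /form_value /section_form; ring. Qed.

Lemma coords_frame (a b c : F) : let v := map_mx iota (a *: row 0 T + b *: row 1 T + c *: row 2 T) in
  [/\ coords iota T v 0 0 = iota a, coords iota T v 0 1 = iota b & coords iota T v 0 2 = iota c].
Proof.
move=> v; have -> : v = of_coords iota T (iota a) (iota b) (iota c).
  by rewrite of_coordsE /v !map_mxD !map_mxZ.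
exact: of_coordsK.
Qed.

Lemma form_value_base c k x y z :
  form_value c (iota (k * x)) (iota (k * y)) (iota (k * z)) 1 =
  iota (k ^+ 4 * section_form L1 L2 N1 N2 m1 m2 (c 0) x y z 1).
Proof.
by rewrite -(rmorph1 iota) form_value_iota; congr (iota _); rewrite /section_form; ring.
Qed.

Lemma form_value_tangent c k b x y :
  form_value c (iota (b * x)) (iota (b * y)) (iota k) 0 =
  iota ((b * k) ^+ 2 * section_form L1 L2 N1 N2 m1 m2 (c 0) x y 1 0).
Proof.
by rewrite -(rmorph0 iota) form_value_iota; congr (iota _); rewrite /section_form; ring.
Qed.

(** Changing the representatives v and w of a point multiplies the value of every
    section by the same nonzero scalar. *)
Lemma local_value_grid y t : rational_point iota P r y -> same_point y (grid_point T t) ->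
  exists2 k, k != 0 & forall c,
    local_value (map_point iota y) (quartic c) = iota (k * gvalue c t).
Proof.
move/(rational_pointE iota T hr); case: t y => d [z|] [v|v w] //=.
  case=> nv _ /(row_eq_scale nv)[k nk vE]; exists (k ^+ 4); rewrite ?expf_neq0 // => c.
  rewrite value_at_quartic; have [] := coords_frame (k * z) (k * px d) (k * py d).
  have <- : v = k * z *: row 0 T + (k * px d) *: row 1 T + (k * py d) *: row 2 T.
    by rewrite vE /tangent !scalerDr !scalerA addrA.
  by move=> -> -> ->; rewrite form_value_base.
case=> _ free /andP[vP /col_mx_eqP[a [b wE]]].
have [k nk vE] := row_eq_scale (row_free_neq0 free) vP.
have nb : b != 0.
  apply/eqP => b0; have /row_free_col_mxP/(_ a (- k))[] := free.
    by rewrite vE wE b0 scale0r addr0 !scalerA mulNr scaleNr mulrC subrr.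
  by move=> _ /eqP; rewrite oppr_eq0 (negbTE nk).
exists ((b * k) ^+ 2) => [|c]; first by rewrite expf_neq0 ?mulf_neq0.
have [] := coords_frame k 0 0.
rewrite !scale0r !addr0 -vE rmorph0 => v0 v1 v2.
have [] := coords_frame a (b * px d) (b * py d).
have <- : w = a *: row 0 T + (b * px d) *: row 1 T + (b * py d) *: row 2 T.
  by rewrite wE /tangent scalerDr !scalerA addrA.
by rewrite expansion_quartic // v0 => _ -> ->; rewrite form_value_tangent.
Qed.

Lemma germ_unique_value y h c : rational_point iota P r y ->
  germ iota P 4 2 1 (map_point iota y) (tofrac h) c -> c = local_value (map_point iota y) h.
Proof.
move/(rational_pointE iota T hr); case: y => [v|v w] /=; first by move=> _ /germ_Off.
by case=> vP _ /germ_Exc[_]; rewrite above_P_base vP.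
Qed.

Lemma vanishes_at_R c v : v != 0 -> above_R F r v -> value_at iota v (quartic c) = 0.
Proof.
move=> nv /existsP[i /(row_eq_scale nv)[k _ ->]].
have r0 : value_at iota (iter i (@frobenius F K) r) (quartic c) = 0.
  elim: (nat_of_ord i) => [|j IH].
    rewrite rE value_at_quartic; have [-> -> ->] := of_coordsK iota unitT (s * ze) (s * al) s.
    exact: form_value_center.
  by rewrite iterS value_at_frobenius IH rmorph0.
move: r0; rewrite !value_at_quartic => r0.
by rewrite !coordsZ form_value_homog r0 mulr0.
Qed.

Lemma above_P_coords v : above_P iota P v ->
  coords iota T v 0 1 = 0 /\ coords iota T v 0 2 = 0.
Proof.
rewrite /above_P => /andP[/sub_rVP[k ->] _].
have [_ e1 e2] := coords_frame 1 0 0; move: e1 e2.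
rewrite !scale0r !addr0 scale1r rmorph0 => e1 e2.
by rewrite !coordsZ e1 e2 mulr0.
Qed.

Lemma quartic_germ c y : on_Y iota P r y ->
  exists a, germ iota P 4 2 1 y (tofrac (quartic c)) a.
Proof.
move=> yY; eexists; apply: germ_tofrac; first exact: quartic_homog.
case: y yY => // v w [vC free]; case: ifP => [/above_P_coords[v1 v2]|nP].
  exact: vanishes_quartic.
move: vC; rewrite nP /= => vR; apply/vanishes_to_orderP => w' [|//] _.
have nv := row_free_neq0 free.
rewrite -horner_coef0 horner_line_restriction scale0r addr0.
exact: vanishes_at_R.
Qed.

Lemma section_is_quartic t : global_section iota P r 4 2 1 t -> exists c, t = tofrac (quartic c).
Proof.
move=> reg; have [h hh tE] := global_section_polynomial (P_neq0 unitT) hr reg.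
suff [c hE] : exists c, h = quartic c by exists c; rewrite tE hE.
apply: (quartic_normal_form unitT al2 Mal (indep_al nal) Qze (indep_ze nze) nzs hh).
  move=> w i free i2; have [|a] := reg (Exc (map_mx iota P) w).
    by split=> //; rewrite above_P_base submx_refl.
  by rewrite tE => /germ_Exc[+ _]; rewrite above_P_base submx_refl; apply.
rewrite -rE.
have [|a] := reg (Exc r (map_mx iota P)).
  split.
    by apply/orP; right; apply/existsP; exists 0; rewrite /= submx_refl.
  apply/row_free_col_mxP => a b e.
  have cE : a * coords iota T r 0 2 + b * coords iota T (map_mx iota P) 0 2 = 0.
    have := congr1 (fun v => coords iota T v 0 2) e.
    by rewrite /coords mulmxDl -!scalemxAl mul0mx mxE [X in X + _]mxE [X in _ + X]mxE [RHS]mxE.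
  have [|_ P2] := @above_P_coords (map_mx iota P); first by rewrite above_P_base submx_refl.
  have [_ _] := of_coordsK iota unitT (s * ze) (s * al) s; rewrite -rE => r2.
  move/eqP: cE; rewrite P2 r2 mulr0 addr0 mulf_eq0 (negbTE nzs) orbF => /eqP a0.
  split=> //; move/eqP: e; rewrite a0 scale0r add0r scaler_eq0 map_mx_eq0.
  by rewrite (negbTE (P_neq0 unitT)) orbF => /eqP.
rewrite tE => /germ_Exc[+ _] => /(_ 0); case: ifP => _ /(_ isT).
  all: by rewrite -coef_line_restriction -horner_coef0 horner_line_restriction scale0r addr0.
Qed.

Variables (n : nat) (y : 'I_n -> blowup_point F) (u : 'I_n -> F).
Hypothesis hy : enumerates_rational_points iota P r y.
Hypothesis hu : forall i, u i != 0.

Lemma grid_enumeration : exists sg : 'I_n -> option F * option F,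
  bijective sg /\ forall i, same_point (y i) (grid_point T (sg i)).
Proof.
case: hy => rat inj surj.
have [sg sgE] := fin_all_exists (fun i => grid_point_surj unitT hr (rat i)).
have [g gE] := fin_all_exists (fun t => surj _ (grid_point_rational iota unitT hr t)).
exists sg; split=> //; exists g => [i|t].
  apply: inj; apply: same_point_trans (_ : same_point _ (grid_point T (sg i))) _.
    by rewrite same_point_sym gE.
  by rewrite same_point_sym.
by apply/esym/(grid_point_inj unitT)/(same_point_trans (gE t)).
Qed.

Definition scaled_values (ka : 'I_n -> F) (sg : 'I_n -> option F * option F) (c : 'rV[F]_8) : 'rV[F]_n :=
  \row_i (ka i * gvalue c (sg i)).

Lemma value_linear k c c' t : gvalue (k *: c + c') t = k * gvalue c t + gvalue c' t.
Proof. by rewrite /value /section_form !mxE; ring. Qed.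

Fact scaled_values_is_linear ka sg : linear (scaled_values ka sg).
Proof.
by move=> k c c'; apply/rowP => i; rewrite !mxE value_linear; ring.
Qed.

HB.instance Definition _ ka sg := GRing.isLinear.Build F 'rV[F]_8 'rV[F]_n _
  (scaled_values ka sg) (scaled_values_is_linear ka sg).

(** Up to a nonzero scalar on each coordinate, the code is the space of values on
    the grid. *)
Lemma code_description : exists ka sg,
  [/\ bijective sg, forall i, ka i != 0 &
    forall w, code_F4 iota P r y u w <-> exists c, w = scaled_values ka sg c].
Proof.
have [sg [bij sgE]] := grid_enumeration; case: hy => rat _ _.
have kaP i : exists k, k != 0 /\ forall c,
    local_value (map_point iota (y i)) (quartic c) = iota (k * gvalue c (sg i)).
  by have [k nk kE] := local_value_grid (rat i) (sgE i); exists k.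
have [ka kaE] := fin_all_exists kaP.
exists (fun i => ka i / u i), sg; split=> // [i|w].
  by rewrite mulf_neq0 ?invr_eq0 ?hu //; case: (kaE i).
split=> [[t [/section_is_quartic[c ->] germs]]|[c ->]].
  exists c; apply/rowP => i; rewrite mxE.
  have /germ_unique_value-/(_ (rat i)) := germs i.
  rewrite (kaE i).2 => /fmorph_inj e.
  by rewrite mulrAC -e mulfK ?hu.
exists (tofrac (quartic c)); split=> [p pY|i]; first exact: quartic_germ.
have [a ga] := quartic_germ c (rat i).
have aE := germ_unique_value (rat i) ga.
rewrite mxE mulrAC divfK ?hu // -(kaE i).2 -aE //.
Qed.

End Code.

Section ScaledCode.
Variables (F : finFieldType) (n : nat) (L1 L2 N1 N2 m1 m2 : F).
Variables (ka : 'I_n -> F) (sg : 'I_n -> option F * option F).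
Hypotheses (bij : bijective sg) (nka : forall i, ka i != 0).
Local Notation q := #|F|.
Local Notation zeros := (zeros L1 L2 N1 N2 m1 m2).
Local Notation codeword := (scaled_values L1 L2 N1 N2 m1 m2 ka sg).

Lemma grid_length : n = ((q + 1) ^ 2)%N.
Proof.
have := bij_eq_card bij.
by rewrite card_ord card_prod card_option addn1 => ->.
Qed.

Lemma codeword_distance c c' :
  hamming_distance (codeword c) (codeword c') = ((q + 1) ^ 2 - #|zeros (c - c')|)%N.
Proof.
rewrite -grid_length -[n in RHS]card_ord (bij_eq_card bij).
rewrite -[zeros _]setCK -cardsCs.
rewrite -(on_card_preimset (f := sg)); last by case: bij => g ? ?; exists g => ? _.
apply: eq_card => i; rewrite !inE -subr_eq0.
have -> : codeword c 0 i - codeword c' 0 i = codeword (c - c') 0 i by rewrite linearB !mxE.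
by rewrite mxE mulf_eq0 (negbTE (nka i)).
Qed.

Variable C : 'rV[F]_n -> Prop.
Hypothesis codeP : forall w, C w <-> exists c, w = codeword c.

Lemma code_dimension :
  (forall d : option F, quad 1 m1 m2 (px d) (py d) != 0) -> has_dimension C 8.
Proof.
move=> Mn0; exists (lin1_mx codeword); split=> [|w].
  rewrite -kermx_eq0; apply/rowV0P => c /sub_kermxP; rewrite mul_rV_lin1 => /rowP c0.
  apply: (value_inj (L1 := L1) (L2 := L2) (N1 := N1) (N2 := N2) Mn0) => t.
  case: bij => g _ gK; have := c0 (g t); rewrite !mxE gK => /eqP.
  by rewrite mulf_eq0 (negbTE (nka _)) => /eqP.
rewrite codeP; split=> [[c ->]|/submxP[c ->]]; last by exists c; rewrite mul_rV_lin1.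
by rewrite -[codeword c]/(codeword c) -mul_rV_lin1 submxMl.
Qed.

End ScaledCode.

Theorem theorem3p4 (F : finFieldType) (K : closedFieldType)
    (iota : {rmorphism F -> K})
    (P : 'rV[F]_3) (l r : 'rV[K]_3)
    (hP : P != 0)
    (hl : quadratic_line F l)
    (hPl : on_line (map_mx iota P) l /\ on_line (map_mx iota P) (frobenius F l))
    (hr : closed_point F 4 r)
    (hrD : on_line r l \/ on_line r (frobenius F l))
    (n : nat) (y : 'I_n -> blowup_point F) (u : 'I_n -> F)
    (hy : enumerates_rational_points iota P r y)
    (hu : forall i, u i != 0) :
  [/\ n = ((#|F| + 1) ^ 2)%N,
      has_dimension (code_F4 iota P r y u) 8
    & (2 < #|F|)%N ->
      has_minimum_distance (code_F4 iota P r y u)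
        (#|F| ^ 2 - #|F| - 2)%N].
Proof.
have [T unitT PE] := exists_unitmx_first_row hP; subst P.
have [al [ze [s [nzs rE [al2 nal] [ze4 nze]]]]] : exists al ze s,
    [/\ s != 0, r = of_coords iota T (s * ze) (s * al) s,
    frob iota (frob iota al) = al /\ frob iota al != al &
    frob iota (frob iota (frob iota (frob iota ze))) = ze /\ frob iota (frob iota ze) != ze].
  case: hPl hrD => Pl Pl' [rl|rl]; first exact: center_parameters unitT hr hl Pl rl.
  apply: center_parameters unitT hr _ Pl' rl.
  case: hl => nl l2 l1; split; first by rewrite (frobeniusE iota) map_mx_eq0.
    by rewrite !(frobeniusE iota) !map_submx.
  by rewrite !(frobeniusE iota) !map_submx.
have [L1 [L2 [N1 [N2 [m1 [m2 [Mal Qze]]]]]]] := center_equations al2 nal ze4.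
have [ka [sg [bij nka codeP]]] := code_description unitT hr nzs rE al2 nal nze Mal Qze hy hu.
have Mn0 := norm_form_neq0 nal Mal.
have noline := conic_no_line al2 nze Mal Qze.
have sep := separable_fibres al2 nze Qze.
split; first exact: grid_length bij.
  exact: code_dimension bij nka _ codeP Mn0.
move=> q3.
have qE : ((#|F| + 1) ^ 2 - (3 * #|F| + 3) = #|F| ^ 2 - #|F| - 2)%N.
  case: #|F| q3 => [|[|[|k]]] // _; nia.
split=> [|x x' /codeP[c ->] /codeP[c' ->] cc'].
  have [c nzc cz] := maximal_zeros Mn0 noline sep q3.
  exists (scaled_values L1 L2 N1 N2 m1 m2 ka sg c), (scaled_values L1 L2 N1 N2 m1 m2 ka sg 0).
  have dist := codeword_distance L1 L2 N1 N2 m1 m2 bij nka c 0.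
  rewrite subr0 cz qE in dist; split=> //; try by apply/codeP; eexists.
  apply/eqP => e; move: dist; rewrite e /hamming_distance.
  rewrite (_ : [set _ | _] = set0) ?cards0; last by apply/setP => i; rewrite !inE eqxx.
  case: #|F| q3 => [|[|[|k]]] // _; nia.
rewrite (codeword_distance _ _ _ _ _ _ bij nka) -qE leq_sub2l // zeros_le //.
by apply: contra cc'; rewrite subr_eq0 => /eqP->.
Qed.
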